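(* Let $\mathrm{Zh}=\mathbb C[z_{11},z_{12},z_{21},z_{22},N(Z)^{-1}]$ with the Lie algebra action $\rho_1$ of $\mathfrak{gl}(2,\mathbb H_{\mathbb C})\simeq\mathfrak{gl}(4,\mathbb C)$ described below. Define $\mathrm{Zh}^+=\operatorname{span}_{\mathbb C}\{t^l_{nm}(Z)N(Z)^k: k\ge0\}$, $\mathrm{Zh}^-=\operatorname{span}_{\mathbb C}\{t^l_{nm}(Z)N(Z)^k: k\le-(2l+2)\}$, $\mathrm{Zh}^0=\operatorname{span}_{\mathbb C}\{t^l_{nm}(Z)N(Z)^k: -(2l+1)\le k\le -1\}$ (with $k\in\mathbb Z$, $l\in\{0,\frac12,1,\dots\}$, $m,n\in\{-l,\dots,l\}$). Then $\mathrm{Zh}=\mathrm{Zh}^-\oplus\mathrm{Zh}^0\oplus\mathrm{Zh}^+$, each of the three summands is invariant under $\rho_1(\mathfrak{gl}(2,\mathbb H_{\mathbb C}))$, and each is an irreducible representation of $\mathfrak{gl}(2,\mathbb H_{\mathbb C})$.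
   Context: $\mathbb H_{\mathbb C}$ is identified with complex $2\times2$ matrices $Z=(z_{ij})$, $N(Z)=\det Z$, and $t^l_{nm}(Z)=\frac1{2\pi i}\oint (sz_{11}+z_{21})^{l-m}(sz_{12}+z_{22})^{l+m}s^{-l+n}\,\frac{ds}{s}$ (loop once counterclockwise around $0$), for $l\in\{0,\frac12,1,\dots\}$, $m,n\in\mathbb Z+l$, $-l\le m,n\le l$. The Lie algebra $\mathfrak{gl}(2,\mathbb H_{\mathbb C})$ consists of block matrices $\begin{pmatrix}A&B\\C&D\end{pmatrix}$ with $A,B,C,D$ complex $2\times2$ matrices. Writing $\partial f$ for the matrix $\begin{pmatrix}\partial f/\partial z_{11}&\partial f/\partial z_{21}\\ \partial f/\partial z_{12}&\partial f/\partial z_{22}\end{pmatrix}$, the action $\rho_1$ on $f\in\mathrm{Zh}$ is $$\rho_1\begin{pmatrix}A&B\\C&D\end{pmatrix}f=\operatorname{Tr}\big(A(-Z\,\partial f-f)\big)+\operatorname{Tr}\big(B(-\partial f)\big)+\operatorname{Tr}\big(C(Z(\partial f)Z+2Zf)\big)+\operatorname{Tr}\big(D((\partial f)Z+f)\big).$$ *)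

(* Defs.v *)
From HB Require Import structures.
From mathcomp Require Import all_boot all_order all_algebra.
From mathcomp Require Import fraction.
Set Implicit Arguments. Unset Strict Implicit. Unset Printing Implicit Defensive.
Import Order.TTheory GRing.Theory Num.Theory.
Local Open Scope ring_scope.

Section Zh.
Variable C : numClosedFieldType.

(* Polynomial ring C[z11,z12,z21,z22] as nested univariate polynomials:
   z22 innermost, then z21, then z12, and z11 outermost. *)
Definition P1 := {poly C}.
Definition P2 := {poly P1}.
Definition P3 := {poly P2}.
Definition P4 := {poly P3}.

Definition z11 : P4 := 'X.
Definition z12 : P4 := ('X : P3)%:P.
Definition z21 : P4 := (('X : P2)%:P)%:P.
Definition z22 : P4 := ((('X : P1)%:P)%:P)%:P.

Definition cst (c : C) : P4 := ((c%:P)%:P)%:P%:P.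

Definition d11 (p : P4) : P4 := deriv p.
Definition d12 (p : P4) : P4 := map_poly (fun q : P3 => deriv q) p.
Definition d21 (p : P4) : P4 :=
  map_poly (fun q : P3 => map_poly (fun r : P2 => deriv r) q) p.
Definition d22 (p : P4) : P4 :=
  map_poly (fun q : P3 => map_poly (fun r : P2 =>
     map_poly (fun u : P1 => deriv u) r) q) p.

Definition NZ : P4 := z11 * z22 - z12 * z21.

(* Zh = C[z_ij, N(Z)^{-1}] realised inside the fraction field of C[z_ij] *)
Definition F := {fraction P4}.
Definition embF (p : P4) : F := @FracField.tofrac P4 p.
Definition cF (c : C) : F := embF (cst c).
Definition NF : F := embF NZ.

Definition zh (p : P4) (k : nat) : F := embF p / NF ^+ k.
Definition isZh (x : F) : Prop := exists (p : P4) (k : nat), x = zh p k.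

Definition dzh (d : P4 -> P4) (p : P4) (k : nat) : F :=
  embF (d p) / NF ^+ k - (k%:R * embF p * embF (d NZ)) / NF ^+ k.+1.

Definition Zmx : 'M[F]_2 :=
  \matrix_(i < 2, j < 2)
    embF (if i == 0 then (if j == 0 then z11 else z12)
                    else (if j == 0 then z21 else z22)).

Definition dmx (p : P4) (k : nat) : 'M[F]_2 :=
  \matrix_(i < 2, j < 2)
    (if i == 0 then (if j == 0 then dzh d11 p k else dzh d21 p k)
               else (if j == 0 then dzh d12 p k else dzh d22 p k)).

Definition cmx (M : 'M[C]_2) : 'M[F]_2 := map_mx cF M.

(* rho_1 of the block matrix (A B; C D) applied to f = p / N^k *)
Definition rho1 (A B Cm D : 'M[C]_2) (p : P4) (k : nat) : F :=
  let f := zh p k in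
  let df := dmx p k in
  \tr (cmx A *m (- (Zmx *m df) - f%:M))
  + \tr (cmx B *m (- df))
  + \tr (cmx Cm *m (Zmx *m df *m Zmx + (2%:R * f) *: Zmx))
  + \tr (cmx D *m (df *m Zmx + f%:M)).

(* t^l_{nm}(Z) with l = (a+b)/2, m = (b-a)/2, n = l - c (so a = l-m,
   b = l+m, c = l-n, 0 <= c <= a+b): the residue
   (1/2πi)∮ (s z11 + z21)^a (s z12 + z22)^b s^{-l+n} ds/s
   is the coefficient of s^c in (s z11 + z21)^a (s z12 + z22)^b. *)
Definition tlnm (a b c : nat) : P4 :=
  (((('X * z11%:P + z21%:P) ^+ a) * (('X * z12%:P + z22%:P) ^+ b))
     : {poly P4})`_c.

Definition tN (a b c : nat) (k : int) : F := embF (tlnm a b c) * NF ^ k.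

(* C-span of the t^l_{nm} N^k with (l,k) satisfying the condition P
   (P receives 2l = a+b and k). *)
Definition ZhSpan (P : nat -> int -> bool) (x : F) : Prop :=
  exists s : seq (C * (nat * nat * nat * int)),
    all (fun e => (e.2.1.2 <= e.2.1.1.1 + e.2.1.1.2)%N
                  && P (e.2.1.1.1 + e.2.1.1.2)%N e.2.2) s
    /\ x = \sum_(e <- s) cF e.1 * tN e.2.1.1.1 e.2.1.1.2 e.2.1.2 e.2.2.

Definition Zh_plus : F -> Prop := ZhSpan (fun l2 k => 0 <= k).
Definition Zh_minus : F -> Prop :=
  ZhSpan (fun l2 k => k <= - (l2%:Z + 2)).
Definition Zh_zero : F -> Prop :=
  ZhSpan (fun l2 k => (- (l2%:Z + 1) <= k) && (k <= -1)).

Definition rho1_invariant (S : F -> Prop) : Prop :=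
  forall (A B Cm D : 'M[C]_2) (p : P4) (k : nat),
    S (zh p k) -> S (rho1 A B Cm D p k).

Definition subspace (W : F -> Prop) : Prop :=
  W 0 /\ (forall x y, W x -> W y -> W (x + y))
  /\ (forall (c : C) x, W x -> W (cF c * x)).

Definition rho1_irreducible (V : F -> Prop) : Prop :=
  (exists x, V x /\ x <> 0) /\
  forall W : F -> Prop, subspace W -> (forall x, W x -> V x) ->
    rho1_invariant W ->
    (forall x, W x -> x = 0) \/ (forall x, V x -> W x).

End Zh.

(* Main.v *)
Require Import Defs.
From HB Require Import structures.
From mathcomp Require Import all_boot all_order all_algebra.
From mathcomp Require Import fraction generic_quotient.
From Stdlib Require Import Classical_Prop.
From mathcomp Require Import ring zify.
Set Implicit Arguments. Unset Strict Implicit. Unset Printing Implicit Defensive.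
Import Order.TTheory GRing.Theory Num.Theory.
Local Open Scope ring_scope.

(** Write u = s z11 + z21 and v = s z12 + z22, so that t(a,b,c) is the
    coefficient of s^c in u^a v^b, and put n = a + b = 2l, f = t(a,b,c) N^k.
    The entries of (df)Z and Z(df) are derivations which move f inside its
    K-type (n,k).  Combined with the expansion of z_ij t(a,b,c) on harmonic
    polynomials, this shows that d_ij f lies in the sum of the K-types (n-1,k)
    and (n+1,k-1), with coefficients proportional to n+1+k and k, and that the
    entries of Z(df)Z + 2Zf lie in the sum of (n+1,k) and (n-1,k+1), with
    coefficients proportional to n+k+2 and k+1.  These coefficients vanish
    exactly on the walls between the three regions of the (n,k)-plane, which
    gives invariance, and within a region every K-type is reached from every
    other one.  The t(a,b,c) N^k are joint eigenvectors, with pairwise distinct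
    eigenvalues a+k, b+k, c+k, a(b+1), of four operators built from the action:
    hence the sum is direct and an invariant subspace contains each component of
    each of its elements. *)

(** * Derivations of commutative rings and fields *)

Definition derivation (R : comNzRingType) (d : R -> R) :=
  {morph d : x y / x + y} /\ (forall x y, d (x * y) = d x * y + x * d y).

Section DerivationTheory.
Variables (R : comNzRingType) (d : R -> R).
Hypothesis d_der : derivation d.

Lemma derD : {morph d : x y / x + y}. Proof. exact: d_der.1. Qed.
Lemma derM x y : d (x * y) = d x * y + x * d y. Proof. exact: d_der.2. Qed.

Lemma der0 : d 0 = 0.
Proof. by apply: (addrI (d 0)); rewrite -derD !addr0. Qed.

Lemma derN x : d (- x) = - d x.
Proof. by apply: (addrI (d x)); rewrite -derD !subrr der0. Qed.

Lemma derB : {morph d : x y / x - y}.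
Proof. by move=> x y; rewrite derD derN. Qed.

Lemma der1 : d 1 = 0.
Proof.
by apply: (addrI (d 1)); rewrite addr0 -[in RHS](mulr1 1) derM mulr1 mul1r.
Qed.

Lemma der_sum (I : Type) (r : seq I) (P : pred I) (f : I -> R) :
  d (\sum_(i <- r | P i) f i) = \sum_(i <- r | P i) d (f i).
Proof. exact: (big_morph d derD der0). Qed.

Lemma derXS x n : d (x ^+ n.+1) = n.+1%:R * x ^+ n * d x.
Proof.
elim: n => [|n IHn]; first by rewrite expr1 expr0 !mul1r.
by rewrite exprS derM IHn -[n.+2]addn1 natrD [x ^+ n.+1]exprS; ring.
Qed.

Lemma derX x n : d (x ^+ n) = n%:R * x ^+ n.-1 * d x.
Proof. by case: n => [|n]; rewrite ?derXS // expr0 der1 !mul0r. Qed.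

(** Acting on coefficients treats the polynomial variable as a constant. This serves both the nested
    polynomial ring and the generating polynomials in s. *)
Lemma der_map_poly : derivation (map_poly d).
Proof.
split=> p q; apply/polyP => i.
  by rewrite coefD !coef_map_id0 ?der0 // coefD derD.
rewrite coefD !coef_map_id0 ?der0 // !coefM der_sum -big_split /=.
by apply: eq_bigr => j _; rewrite derM !coef_map_id0 ?der0.
Qed.

End DerivationTheory.

Section FieldDerivation.
Variables (K : fieldType) (d : K -> K).
Hypothesis d_der : derivation d.

Lemma derV (x : K) : x != 0 -> d x^-1 = - d x / x ^+ 2.
Proof.
move=> x0; apply: (mulfI x0); apply: (addrI (d x * x^-1)).
by rewrite -(derM d_der) divff // (der1 d_der); field.
Qed.

Lemma derXz (x : K) k : x != 0 -> d (x ^ k) = k%:~R * x ^ (k - 1) * d x.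
Proof.
move=> x0.
have derXn n : d (x ^ n%:Z) = n%:R * x ^ (n%:Z - 1) * d x.
  case: n => [|n]; first by rewrite expr0z (der1 d_der) !mul0r.
  by rewrite -exprnP (derXS d_der) intS [1 + _]addrC addrK.
case: (intP k) => [|n|n]; [exact: (derXn 0%N)|exact: (derXn n.+1)|].
have xn0 : x ^ n.+1%:Z != 0 by rewrite expfz_neq0.
rewrite -invr_expz (derV) // derXn mulrNz !mulNr; congr (- _).
have -> : (- n.+1%:Z - 1 = (n.+1%:Z - 1) - n.+1%:Z - n.+1%:Z)%R by lia.
by rewrite !expfzDr // -!invr_expz; field; rewrite x0 xn0.
Qed.

End FieldDerivation.

(** * Extension of a derivation to a field of fractions *)

Section FractionDerivation.
Variables (R : idomainType) (K : fieldType) (phi : {rmorphism R -> K}).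
Variables (num den : K -> R).
Hypothesis phi_inj : injective phi.
Hypothesis den_neq0 : forall x, den x != 0.
Hypothesis numden : forall x, x = phi (num x) / phi (den x).
Variable d : R -> R.
Hypothesis d_der : derivation d.

Definition der_frac (x : K) : K :=
  phi (d (num x) * den x - num x * d (den x)) / phi (den x) ^+ 2.

Let phi_neq0 x : x != 0 -> phi x != 0.
Proof. by move=> x0; rewrite -(rmorph0 phi) (inj_eq phi_inj). Qed.

(** The quotient rule is independent of the chosen fraction: two representatives are linked by
    [n' * m = n * m'], and applying [d] to this relation links their derivatives. *)
Lemma der_frac_div n m : m != 0 ->
  der_frac (phi n / phi m) = phi (d n * m - n * d m) / phi m ^+ 2.
Proof.
move=> m0; rewrite /der_frac.
set y := phi n / phi m.
have := numden y; set n' := num _; set m' := den _ => Ey.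
have m'0 : m' != 0 by exact: den_neq0.
have M0 : phi m != 0 by exact: phi_neq0.
have M'0 : phi m' != 0 by exact: phi_neq0.
have E : n' * m = n * m'.
  apply: phi_inj; rewrite !rmorphM /=; apply/eqP.
  by rewrite -eqr_div // -Ey.
have E' : d n' * m + n' * d m = d n * m' + n * d m'.
  by rewrite -!(derM d_der) E.
apply/eqP; rewrite eqr_div ?expf_neq0 // -!rmorphXn -!rmorphM (inj_eq phi_inj).
apply/eqP.
(* Regrouped so that [n'] and [d n'] occur only through [n' * m] and its derivative, where [E] and
   [E'] apply. *)
have -> : (d n' * m' - n' * d m') * m ^+ 2 =
  (d n' * m + n' * d m) * m * m' - (n' * m) * (d m * m' + d m' * m) by ring.
by rewrite E' E; ring.
Qed.

Lemma der_frac_phi p : der_frac (phi p) = phi (d p).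
Proof.
have := @der_frac_div p 1 (oner_neq0 _).
by rewrite rmorph1 divr1 expr1n divr1 mulr1 (der1 d_der) mulr0 subr0.
Qed.

Lemma der_frac_der : derivation der_frac.
Proof.
split=> x y; rewrite (numden x) (numden y);
  move: (num x) (den x) (den_neq0 x) (num y) (den y) (den_neq0 y)
    => n m m0 p q q0; have M0 := phi_neq0 m0; have Q0 := phi_neq0 q0;
  have mq0 : m * q != 0 by rewrite mulf_neq0.
  have -> : phi n / phi m + phi p / phi q = phi (n * q + p * m) / phi (m * q).
    by rewrite rmorphD !rmorphM /=; field; rewrite M0 Q0.
  rewrite !der_frac_div // (derD d_der) !(derM d_der).
  by rewrite !(rmorphM, rmorphD, rmorphB) /=; field; rewrite M0 Q0.
have -> : phi n / phi m * (phi p / phi q) = phi (n * p) / phi (m * q).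
  by rewrite !rmorphM /=; field; rewrite M0 Q0.
rewrite !der_frac_div // !(derM d_der).
by rewrite !(rmorphM, rmorphD, rmorphB) /=; field; rewrite M0 Q0.
Qed.

End FractionDerivation.

Lemma fraction_numden (R : idomainType) (x : {fraction R}) :
  x = FracField.tofrac (\n_(repr x)) / FracField.tofrac (\d_(repr x)).
Proof.
have d0 : FracField.tofrac (\d_(repr x)) != 0.
  by rewrite tofrac_eq0 denom_ratioP.
apply: (mulIf d0); rewrite divfK //.
(* Multiplication in the fraction field is defined on representatives, so the claim becomes an
   equivalence of ratios. *)
rewrite -[in LHS](reprK x) -[LHS]/(FracField.mul _ _).
rewrite !piE; apply/eqmodP; rewrite /= FracField.equivfE /FracField.mulf.
by rewrite !numden_Ratio ?mulf_neq0 ?oner_eq0 ?denom_ratioP // reprK !mulr1 mulrC.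
Qed.

(** * Separation of joint eigenvectors inside an invariant subspace *)

Section Separation.
Variables (C : numFieldType) (F : fieldType) (cF : {rmorphism C -> F}).

(** Convertible to [subspace] once [cF] is the concrete embedding of the constants. *)
Definition closed_sub (W : F -> Prop) : Prop :=
  W 0 /\ (forall x y, W x -> W y -> W (x + y))
  /\ (forall (c : C) x, W x -> W (cF c * x)).

Section ClosedSub.
Variables (W : F -> Prop) (W_sub : closed_sub W).

Lemma sub0 : W 0. Proof. exact: W_sub.1. Qed.
Lemma subD x y : W x -> W y -> W (x + y). Proof. exact: W_sub.2.1. Qed.
Lemma subZ c x : W x -> W (cF c * x). Proof. exact: W_sub.2.2. Qed.

(** Membership is asked only when the coefficient is nonzero: this is how the vanishing of
    coefficients on the walls enters the proof of invariance. *)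
Lemma subZint (m : int) x : (m != 0 -> W x) -> W (m%:~R * x).
Proof.
have [->|m0 /(_ isT) Wx] := eqVneq m 0; first by rewrite mul0r => _; exact: sub0.
by rewrite -(rmorph_int cF); exact: subZ.
Qed.

(** Nonzero integers are invertible in characteristic zero; this clears the factor n + 1 in the
    formulas for the action. *)
Lemma subZint_cancel (m : int) x : m != 0 -> W (m%:~R * x) -> W x.
Proof.
move=> m0 /(subZ m%:~R^-1); rewrite mulrA -(rmorph_int cF) -rmorphM mulVf.
  by rewrite rmorph1 mul1r.
by rewrite intr_eq0.
Qed.

Lemma subN x : W x -> W (- x).
Proof. by move=> Wx; rewrite -mulN1r -(rmorphN1 cF); exact: subZ. Qed.

Lemma subB x y : W x -> W y -> W (x - y).
Proof. by move=> Wx Wy; apply: subD => //; exact: subN. Qed.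

Lemma sub_sum (I : Type) (r : seq I) (Q : pred I) (f : I -> F) :
  (forall i, Q i -> W (f i)) -> W (\sum_(i <- r | Q i) f i).
Proof. by move=> Wf; elim/big_ind: _ => //; [exact: sub0|exact: subD]. Qed.

End ClosedSub.

Variables (K : eqType) (v : K -> F).

(** A key may occur several times in [s], so a component collects all the terms with that key. *)
Lemma big_by_key (s : seq (C * K)) (Q : pred K) (f : C * K -> F) :
  \sum_(e <- s | Q e.2) f e =
  \sum_(q <- undup (map snd s) | Q q) \sum_(e <- s | e.2 == q) f e.
Proof.
rewrite (exchange_big_dep (fun e => Q e.2)) /=; last by move=> q e Qq /eqP ->.
rewrite big_seq_cond [RHS]big_seq_cond; apply: eq_bigr => e /andP[es Qe].
rewrite (eq_bigl (fun q => q == e.2)); last first.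
  by move=> q; rewrite [in LHS]eq_sym; case: eqP => [->|_]; rewrite ?Qe ?andbF.
rewrite -big_filter filter_pred1_uniq ?undup_uniq ?mem_undup ?map_f //.
by rewrite big_seq1.
Qed.

Variables (I : Type) (T : I -> F -> F) (mu : I -> K -> int).
Hypothesis T_add : forall i, {morph T i : x y / x + y}.
Hypothesis T_scale : forall i c x, T i (cF c * x) = cF c * T i x.
Hypothesis T_eigen : forall i q, T i (v q) = (mu i q)%:~R * v q.
Hypothesis mu_sep : forall q q', q != q' -> exists i, mu i q != mu i q'.

Variables (W : F -> Prop) (W_sub : closed_sub W).
Hypothesis W_T : forall i x, W x -> W (T i x).

(* The product over the unwanted keys q' of the operators T_i - mu_i(q') kills
   the corresponding eigenvectors and acts on v q by a nonzero scalar. *)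
Lemma sub_component (s : seq (C * K)) q :
  W (\sum_(e <- s) cF e.1 * v e.2) ->
  W (\sum_(e <- s | e.2 == q) cF e.1 * v e.2).
Proof.
move=> Ws.
(* [g k] is the scalar by which the product of the operators applied so far acts on [v k]. *)
have [g [gq gs Wg]] : exists g : K -> C, [/\ g q != 0,
    forall q', q' \in map snd s -> q' != q -> g q' = 0 &
    W (\sum_(e <- s) cF (g e.2 * e.1) * v e.2)].
  elim: (map snd s) => [|q1 r [g [gq gr Wg]]].
    exists (fun=> 1); split=> //; first exact: oner_neq0.
    by under eq_bigr do rewrite mul1r.
  have [Eq1|q1q] := eqVneq q1 q.
    exists g; split=> // q'; rewrite inE Eq1.
    by case/orP=> [/eqP-> |/gr//]; rewrite eqxx.
  have [i mui] : exists i, mu i q != mu i q1 by apply: mu_sep; rewrite eq_sym.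
  exists (fun k => (mu i k - mu i q1)%:~R * g k); split=> [|q'|].
  - by rewrite mulf_neq0 // intr_eq0 subr_eq0.
  - rewrite inE => /orP[/eqP-> _|q'r q'q]; first by rewrite subrr mul0r.
    by rewrite gr ?mulr0.
  have -> : \sum_(e <- s) cF ((mu i e.2 - mu i q1)%:~R * g e.2 * e.1) * v e.2 =
    T i (\sum_(e <- s) cF (g e.2 * e.1) * v e.2)
    - (mu i q1)%:~R * \sum_(e <- s) cF (g e.2 * e.1) * v e.2.
    have T0 : T i 0 = 0 by apply: (addrI (T i 0)); rewrite -T_add !addr0.
    rewrite (big_morph (T i) (T_add i) T0) mulr_sumr -sumrB.
    apply: eq_bigr => e _; rewrite T_scale T_eigen !rmorphM rmorph_int intrB.
    by rewrite /=; ring.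
  by apply: (subB W_sub); [exact: W_T|apply: (subZint W_sub)].
have -> : \sum_(e <- s | e.2 == q) cF e.1 * v e.2 =
    cF (g q)^-1 * \sum_(e <- s) cF (g e.2 * e.1) * v e.2.
  rewrite mulr_sumr [RHS](bigID (fun e => e.2 == q)) /= [X in _ = _ + X]big1_seq ?addr0.
    apply: eq_bigr => e /eqP->; rewrite mulrA -rmorphM mulrA mulVf // mul1r //.
  move=> e /andP[eq es]; rewrite (gs _ (map_f snd es) eq).
  by rewrite mul0r rmorph0 mul0r mulr0.
exact: (subZ W_sub).
Qed.

Lemma sub_filter (s : seq (C * K)) (Q : pred K) :
  W (\sum_(e <- s) cF e.1 * v e.2) ->
  W (\sum_(e <- s | Q e.2) cF e.1 * v e.2).
Proof.
move=> Ws; rewrite big_by_key; apply: (sub_sum W_sub) => q _.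
exact: sub_component.
Qed.

Lemma sub_two (x y : C) p q : p != q ->
  W (cF x * v p + cF y * v q) -> W (cF x * v p).
Proof.
move=> pq Wxy; have := @sub_component [:: (x, p); (y, q)] p.
rewrite !big_cons !big_nil /= eqxx eq_sym (negbTE pq) !addr0; exact.
Qed.

(** A nonzero element has a nonzero component, which lies in [W] and is a nonzero multiple of one
    eigenvector. *)
Lemma sub_exists (s : seq (C * K)) :
  let x := \sum_(e <- s) cF e.1 * v e.2 in
  W x -> x != 0 -> exists2 q, q \in map snd s & W (v q).
Proof.
move=> x Wx x0.
have /hasP[q qs xq0] : has (fun q => \sum_(e <- s | e.2 == q) cF e.1 * v e.2 != 0)
    (undup (map snd s)).
  apply: contraNT x0 => /hasPn xq0; rewrite /x (big_by_key s predT) big1_seq //.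
  by move=> q /xq0; rewrite negbK => /eqP.
rewrite mem_undup in qs; exists q => //.
have := sub_component q Wx.
have Eq : \sum_(e <- s | e.2 == q) cF e.1 * v e.2 =
    cF (\sum_(e <- s | e.2 == q) e.1) * v q.
  by rewrite rmorph_sum mulr_suml; apply: eq_bigr => e /eqP->.
rewrite Eq in xq0 *; set c := \sum_(e <- s | _) _ in xq0 * => Wq.
have c0 : c != 0 by apply: contraNneq xq0 => ->; rewrite rmorph0 mul0r.
rewrite -[v q]mul1r -(rmorph1 cF) -(mulVf c0) rmorphM -mulrA.
exact: (subZ W_sub).
Qed.
End Separation.

Lemma sum2 (V : nmodType) (f : 'I_2 -> V) : \sum_(i < 2) f i = f 0 + f 1.
Proof.
rewrite !big_ord_recl big_ord0 addr0; congr (f _ + f _); exact: val_inj.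
Qed.

(** * Identities for the matrix coefficients t(a,b,c) of an arbitrary 2 x 2 matrix *)

Section MatrixCoefficients.
Variables (F : fieldType) (z : 'M[F]_2).
Local Notation z11 := (z 0 0).
Local Notation z12 := (z 0 1).
Local Notation z21 := (z 1 0).
Local Notation z22 := (z 1 1).

Definition detz : F := z11 * z22 - z12 * z21.
Definition gen_u : {poly F} := 'X * z11%:P + z21%:P.
Definition gen_v : {poly F} := 'X * z12%:P + z22%:P.
Definition gen (a b : nat) : {poly F} := gen_u ^+ a * gen_v ^+ b.
Definition t (a b c : nat) : F := (gen a b)`_c.
(* [tp a b c] is [t a b (c - 1)], read as [0] when [c = 0]. *)
Definition tp (a b c : nat) : F := ('X * gen a b)`_c.

Lemma tp0 a b : tp a b 0 = 0. Proof. by rewrite /tp coefXM. Qed.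
Lemma tpS a b c : tp a b c.+1 = t a b c. Proof. by rewrite /tp coefXM. Qed.

Lemma tSa a b c : t a.+1 b c = z11 * tp a b c + z21 * t a b c.
Proof.
rewrite /t /tp /gen exprS -mulrA mulrDl coefD mulrAC mulrC coefCM.
by rewrite coefCM.
Qed.

Lemma tSb a b c : t a b.+1 c = z12 * tp a b c + z22 * t a b c.
Proof.
rewrite /t /tp /gen exprS mulrCA mulrDl coefD mulrAC mulrC coefCM.
by rewrite coefCM.
Qed.

Lemma t000 : t 0 0 0 = 1.
Proof. by rewrite /t /gen !expr0 mulr1 coef1. Qed.

(** u^a v^b has degree at most a + b in s. *)
Lemma t_out a b c : (a + b < c)%N -> t a b c = 0.
Proof.
elim: a b c => [|a IHa] b c.
  elim: b c => [|b IHb] [|c] //= bc.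
    by rewrite /t /gen !expr0 mulr1 coef1.
  by rewrite tSb tpS !IHb ?mulr0 ?addr0 //; lia.
case: c => [|c] //= ac.
by rewrite tSa tpS !IHa ?mulr0 ?addr0 //; lia.
Qed.

(** At exponent 0 the value of [a.-1] or [b.-1] does not matter, since the factor in front vanishes;
    this convention is used throughout. *)
Lemma deriv_gen a b : (gen a b)^`() =
  a%:R *: (z11%:P * gen a.-1 b) + b%:R *: (z12%:P * gen a b.-1).
Proof.
have du : gen_u^`() = z11%:P by rewrite /gen_u !derivE mul1r mulr0 !addr0.
have dv : gen_v^`() = z12%:P by rewrite /gen_v !derivE mul1r mulr0 !addr0.
rewrite /gen derivM !deriv_exp du dv !scaler_nat; ring.
Qed.

Lemma t_deriv a b c : c.+1%:R * t a b c.+1 =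
  a%:R * (z11 * t a.-1 b c) + b%:R * (z12 * t a b.-1 c).
Proof.
by rewrite /t mulr_natl -coef_deriv deriv_gen coefD !coefZ !coefCM.
Qed.

Lemma t_deriv0 a b c : c%:R * t a b c =
  a%:R * (z11 * tp a.-1 b c) + b%:R * (z12 * tp a b.-1 c).
Proof.
by case: c => [|c]; rewrite ?tp0 ?tpS ?t_deriv // mul0r !mulr0 addr0.
Qed.

(* These come from d/ds (u^(a+1) v^b) and d/ds (u^a v^(b+1)) together with
   N = z11 v - z12 u. *)
Lemma mul_z11 a b c : (a + b).+1%:R * (z11 * t a b c) =
  c.+1%:R * t a.+1 b c.+1 + b%:R * (detz * t a b.-1 c).
Proof.
rewrite t_deriv /=; case: b => [|b] /=; first by rewrite addn0; ring.
rewrite tSa tSb /detz.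
ring.
Qed.

Lemma mul_z12 a b c : (a + b).+1%:R * (z12 * t a b c) =
  c.+1%:R * t a b.+1 c.+1 - a%:R * (detz * t a.-1 b c).
Proof.
rewrite t_deriv /=; case: a => [|a] /=; first by rewrite add0n; ring.
rewrite tSa tSb /detz; ring.
Qed.

Lemma mul_z21 a b c : (a + b).+1%:R * (z21 * t a b c) =
  ((a + b).+1%:R - c%:R) * t a.+1 b c - b%:R * (detz * tp a b.-1 c).
Proof.
(* The recursion for u u^a v^b trades z21 for z11 one degree lower in s, where [mul_z11] applies. *)
have -> : z21 * t a b c = t a.+1 b c - z11 * tp a b c by rewrite tSa; ring.
case: c => [|c]; first by rewrite !tp0; ring.
by rewrite mulrBr !tpS mul_z11; ring.
Qed.

Lemma mul_z22 a b c : (a + b).+1%:R * (z22 * t a b c) =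
  ((a + b).+1%:R - c%:R) * t a b.+1 c + a%:R * (detz * tp a.-1 b c).
Proof.
have -> : z22 * t a b c = t a b.+1 c - z12 * tp a b c by rewrite tSb; ring.
case: c => [|c]; first by rewrite !tp0; ring.
by rewrite mulrBr !tpS mul_z12; ring.
Qed.

(** Made homogeneous of degree a + b in s and a second variable, u^a v^b satisfies Euler's identity;
    [t_deriv0] is the s-part and this is the complementary part. *)
Lemma t_deriv1 a b c : (a%:R + b%:R - c%:R) * t a b c =
  a%:R * (z21 * t a.-1 b c) + b%:R * (z22 * t a b.-1 c).
Proof.
rewrite mulrBl t_deriv0 mulrDl.
have -> : a%:R * t a b c = a%:R * (z11 * tp a.-1 b c + z21 * t a.-1 b c).
  by case: a => [|a]; rewrite ?tSa // !mul0r.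
have -> : b%:R * t a b c = b%:R * (z12 * tp a b.-1 c + z22 * t a b.-1 c).
  by case: b => [|b]; rewrite ?tSb // !mul0r.
ring.
Qed.

Lemma tp_deriv1 a b c : ((a + b).+1%:R - c%:R) * tp a b c =
  a%:R * (z21 * tp a.-1 b c) + b%:R * (z22 * tp a b.-1 c).
Proof.
case: c => [|c]; first by rewrite !tp0; ring.
by rewrite !tpS -t_deriv1; ring.
Qed.

Definition tdet (a b c : nat) (k : int) : F := t a b c * detz ^ k.
Definition tpdet (a b c : nat) (k : int) : F := tp a b c * detz ^ k.

Section DerivationAction.
Variables (d : F -> F) (d_der : derivation d).

(** The derivation acts coefficientwise and so kills s; the rest is the Leibniz rule for u^a v^b. *)
Lemma der_t a b c : d (t a b c) =
  a%:R * (d z11 * tp a.-1 b c + d z21 * t a.-1 b c)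
  + b%:R * (d z12 * tp a b.-1 c + d z22 * t a b.-1 c).
Proof.
have dP := der_map_poly d_der.
have dXC x y : map_poly d ('X * x%:P + y%:P) = 'X * (d x)%:P + (d y)%:P.
  apply/polyP=> i; rewrite coef_map_id0 ?(der0 d_der) // !coefD !coefXM !coefC.
  by case: i => [|[|i]] /=; rewrite (derD d_der) ?(der0 d_der).
rewrite -[LHS](coef_map_id0 _ _ (der0 d_der)).
have -> : map_poly d (gen a b) =
    a%:R *: ((d z11)%:P * ('X * gen a.-1 b) + (d z21)%:P * gen a.-1 b)
    + b%:R *: ((d z12)%:P * ('X * gen a b.-1) + (d z22)%:P * gen a b.-1).
  by rewrite (derM dP) !(derX dP) !dXC /gen !scaler_nat; ring.
by rewrite !(coefD, coefZ, coefCM).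
Qed.

Lemma der_detz : d detz =
  d z11 * z22 + z11 * d z22 - (d z12 * z21 + z12 * d z21).
Proof. by rewrite (derB d_der) !(derM d_der). Qed.

Hypothesis detz_neq0 : detz != 0.

(** [d] enters only through its values on the entries of [z], so one formula covers the partial
    derivatives and the entries of Z(df) and (df)Z. *)
Lemma der_tdet a b c k : d (tdet a b c k) =
  (a%:R * (d z11 * tp a.-1 b c + d z21 * t a.-1 b c)
   + b%:R * (d z12 * tp a b.-1 c + d z22 * t a b.-1 c)) * detz ^ k
  + k%:~R * t a b c * detz ^ (k - 1) *
    (d z11 * z22 + z11 * d z22 - (d z12 * z21 + z12 * d z21)).
Proof.
by rewrite (derM d_der) der_t (derXz d_der) // der_detz; ring.
Qed.

End DerivationAction.
End MatrixCoefficients.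

(* The K-types (2l, k) reached from a given one by the off-diagonal blocks B
   and C; the inequations say that the coefficient of the step is nonzero. *)
Definition moves (Q : nat -> int -> Prop) : Prop :=
  [/\ forall n k, n%:Z + 2 + k != 0 -> Q n.+1 k -> Q n k,
      forall n k, k != 0 -> Q n k -> Q n.+1 (k - 1),
      forall n k, n%:Z + k + 2 != 0 -> Q n k -> Q n.+1 k
    & forall n k, k + 1 != 0 -> Q n.+1 k -> Q n (k + 1)].

(** * The three regions of the (n,k)-plane: closure under the steps and connectedness *)

Definition plus_type (n : nat) (k : int) : bool := 0 <= k.
Definition minus_type (n : nat) (k : int) : bool := k <= - (n%:Z + 2).
Definition zero_type (n : nat) (k : int) : bool :=
  (- (n%:Z + 1) <= k) && (k <= -1).

(** A step out of a region occurs only where its coefficient vanishes: lowering k from 0 for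
    [plus_type], raising n from k = -(n+2) for [minus_type], and the two steps lowering n across a
    wall for [zero_type]. *)
Lemma plus_moves : moves plus_type.
Proof. by rewrite /plus_type; split=> n k; lia. Qed.

Lemma minus_moves : moves minus_type.
Proof. by rewrite /minus_type; split=> n k; lia. Qed.

Lemma zero_moves : moves zero_type.
Proof. by rewrite /zero_type; split=> n k; lia. Qed.

(** Mutual reachability by steps with nonzero coefficient, phrased through all predicates closed
    under these steps; [Q] will be the set of K-types contained in an invariant subspace. *)
Definition connected (P : nat -> int -> bool) : Prop :=
  forall Q, moves Q -> forall n k n' k', P n k -> P n' k' -> Q n k -> Q n' k'.

(** The path goes through the origin. On the edge n = 0 a diagonal step and a horizontal one
    together change j by one. *)
Lemma triangular_grid (Q : nat -> nat -> Prop) :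
  (forall n j, Q n.+1 j -> Q n j) -> (forall n j, Q n j.+1 -> Q n.+1 j) ->
  (forall n j, Q n j -> Q n.+1 j) -> (forall n j, Q n.+1 j -> Q n j.+1) ->
  forall n j n' j', Q n j -> Q n' j'.
Proof.
move=> left_ left_up right_ right_down n j n' j' Qnj.
have Q0j : Q 0 j by elim: n Qnj => // n IHn /left_.
have Q00 : Q 0 0 by elim: j Q0j {Qnj} => // j IHj /left_up/left_.
have Q0j' : Q 0 j' by elim: j' => // j' IHj; exact/right_down/right_.
by elim: n' => // n' IHn; exact: right_.
Qed.

Lemma plus_connected : connected plus_type.
Proof.
move=> Q [Q1 Q2 Q3 Q4] n [] // k n' [] // k' _ _.
apply: (triangular_grid (Q := fun n j => Q n j%:Z)) => {k k'}{}n j Qn.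
- by apply: Q1 => //; lia.
- by have -> : j%:Z = j.+1%:Z - 1; [lia|exact: Q2].
- by apply: Q3 => //; lia.
- by have -> : j.+1%:Z = j%:Z + 1; [lia|apply: Q4 => //; lia].
Qed.

Lemma minus_connected : connected minus_type.
Proof.
move=> Q [Q1 Q2 Q3 Q4] n k n' k'; rewrite /minus_type => nk nk'.
have coord m l : l <= - (m%:Z + 2) -> l = - (m%:Z + 2) - (absz (- (m%:Z + 2) - l))%:Z.
  by move=> ml; lia.
rewrite (coord n k nk) (coord n' k' nk').
(* Here j is the distance from k to the wall k = -(n+2). In these coordinates the four steps are
   again those of the triangular grid, in a permuted order. *)
apply: (triangular_grid (Q := fun n j => Q n (- (n%:Z + 2) - j%:Z)))
  => {k k' nk nk' n'}{}n j Qn.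
- have -> : - (n%:Z + 2) - j%:Z = - (n.+1%:Z + 2) - j%:Z + 1 by lia.
  by apply: Q4 => //; lia.
- have -> : - (n.+1%:Z + 2) - j%:Z = - (n%:Z + 2) - j.+1%:Z by lia.
  by apply: Q3 => //; lia.
- have -> : - (n.+1%:Z + 2) - j%:Z = - (n%:Z + 2) - j%:Z - 1 by lia.
  by apply: Q2 => //; lia.
- have -> : - (n%:Z + 2) - j.+1%:Z = - (n.+1%:Z + 2) - j%:Z by lia.
  by apply: Q1 => //; lia.
Qed.

Lemma zero_connected : connected zero_type.
Proof.
move=> Q [Q1 Q2 Q3 Q4] n k n' k'; rewrite /zero_type.
(* With k = -1 - i and n = i + j the region becomes the quadrant i, j >= 0, and each step changes
   exactly one of i and j by one. *)
pose R i j := Q (i + j)%N (- 1 - i%:Z).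
have coord m l : (- (m%:Z + 1) <= l) && (l <= -1) ->
    exists i j, m = (i + j)%N /\ l = - 1 - i%:Z.
  by move=> ml; exists (absz (- 1 - l)%R), (m - absz (- 1 - l)%R)%N; lia.
move=> /coord [i [j [-> ->]]] /coord [i' [j' [-> ->]]].
have to_00 i0 j0 : R i0 j0 -> R 0 0.
  elim: i0 j0 => [|i0 IHi] j0 Rij.
    elim: j0 Rij => // j0 IHj Rj; apply: IHj; apply: Q1; last exact: Rj.
    by lia.
  apply: (IHi j0); rewrite /R; have -> : - 1 - i0%:Z = - 1 - i0.+1%:Z + 1 by lia.
  by apply: Q4; [lia|exact: Rij].
have from_00 i0 j0 : R 0 0 -> R i0 j0.
  move=> R00; elim: i0 => [|i0 IHi].
    elim: j0 => // j0 IHj; rewrite /R addnS; apply: Q3; last exact: IHj.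
    by lia.
  rewrite /R addSn; have -> : - 1 - i0.+1%:Z = - 1 - i0%:Z - 1 by lia.
  by apply: Q2; [lia|exact: IHi].
by move=> /to_00; exact: from_00.
Qed.

(** * Abstract model: a field with coordinates z_ij and their partial derivatives *)

Section Model.
Variables (C : numFieldType) (F : fieldType) (cF : {rmorphism C -> F}).
Variables (z : 'M[F]_2) (D : 'I_2 -> 'I_2 -> F -> F).
Hypothesis D_der : forall i j, derivation (D i j).
Hypothesis D_cst : forall i j c, D i j (cF c) = 0.
Hypothesis D_z : forall i j k l, D i j (z k l) = ((i == k) && (j == l))%:R.
Local Notation N := (detz z).
Local Notation t := (t z).
Local Notation tp := (tp z).
Local Notation tdet := (tdet z).
Local Notation tpdet := (tpdet z).

(* The entries of (df)Z and of Z(df): again derivations, hence determined by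
   their values on the z_ij. *)
Definition colop i j f := D 0 i f * z 0 j + D 1 i f * z 1 j.
Definition rowop i j f := D j 0 f * z i 0 + D j 1 f * z i 1.

Let neq01 : (0 == 1 :> 'I_2) = false. Proof. by []. Qed.
Let neq10 : (1 == 0 :> 'I_2) = false. Proof. by []. Qed.

(** Differentiating N = 0 by z11 would give z22 = 0, and then by z22 would give 1 = 0. *)
Lemma detz_neq0 : N != 0.
Proof.
apply/eqP => N0; have := der_detz z (D_der 0 0).
rewrite N0 (der0 (D_der 0 0)) !D_z !eqxx neq01 /=.
rewrite mul1r mul0r !mulr0 !addr0 subr0 => z22.
have := D_z 1 1 1 1; rewrite -z22 (der0 (D_der 1 1)) eqxx => /esym/eqP.
by rewrite oner_eq0.
Qed.
Local Hint Resolve detz_neq0 : core.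

Lemma comb_der (d e : F -> F) x y : derivation d -> derivation e ->
  derivation (fun f => d f * x + e f * y).
Proof.
move=> d_der e_der; split=> f g; first by rewrite !(derD d_der, derD e_der); ring.
by rewrite (derM d_der) (derM e_der); ring.
Qed.

Lemma colop_der i j : derivation (colop i j). Proof. exact: comb_der. Qed.
Lemma rowop_der i j : derivation (rowop i j). Proof. exact: comb_der. Qed.

(** Leaves only the power N^(k-1) in the formulas; once it is generalised, they are polynomial
    identities for [ring]. *)
Lemma exprzS k : N ^ k = N * N ^ (k - 1).
Proof.
have {1}-> : k = 1 + (k - 1) by rewrite addrC subrK.
by rewrite (expfzDr 1) ?expr1z.
Qed.

Lemma colop_z i j k l : colop i j (z k l) = (i == l)%:R * z k j.
Proof.
rewrite /colop !D_z; have: k = 0 \/ k = 1.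
  by case: k => [[|[]]] //= ?; [left|right]; exact: val_inj.
by case=> ->; rewrite eqxx ?neq01 ?neq10 /=; ring.
Qed.

Lemma rowop_z i j k l : rowop i j (z k l) = (j == k)%:R * z i l.
Proof.
rewrite /rowop !D_z; have: l = 0 \/ l = 1.
  by case: l => [[|[]]] //= ?; [left|right]; exact: val_inj.
by case=> ->; rewrite eqxx ?neq01 ?neq10 ?andbT ?andbF /=; ring.
Qed.

Let colE i j a b c k := @der_tdet F z _ (colop_der i j) detz_neq0 a b c k.
Let rowE i j a b c k := @der_tdet F z _ (rowop_der i j) detz_neq0 a b c k.
Let DE i j a b c k := @der_tdet F z _ (D_der i j) detz_neq0 a b c k.
Let simp01 := (eqxx, neq01, neq10, mul0r, mul1r, mulr0, mulr1, add0r, addr0).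

(** * Operators that preserve a K-type: [colop] moves (a,b), [rowop] moves c *)

Lemma colop00 a b c k : colop 0 0 (tdet a b c k) = (a%:Z + k)%:~R * tdet a b c k.
Proof.
rewrite colE !colop_z !simp01 /tdet exprzS; move: (N ^ _) => g; rewrite /detz.
by case: a => [|a]; rewrite /= ?tSa; ring.
Qed.

Lemma colop01 a b c k : colop 0 1 (tdet a b c k) = a%:Z%:~R * tdet a.-1 b.+1 c k.
Proof.
rewrite colE !colop_z !simp01 /tdet exprzS tSb; move: (N ^ _) => g.
by rewrite /detz; ring.
Qed.

Lemma colop10 a b c k : colop 1 0 (tdet a b c k) = b%:Z%:~R * tdet a.+1 b.-1 c k.
Proof.
rewrite colE !colop_z !simp01 /tdet exprzS tSa; move: (N ^ _) => g.
by rewrite /detz; ring.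
Qed.

Lemma colop11 a b c k : colop 1 1 (tdet a b c k) = (b%:Z + k)%:~R * tdet a b c k.
Proof.
rewrite colE !colop_z !simp01 /tdet exprzS; move: (N ^ _) => g; rewrite /detz.
by case: b => [|b]; rewrite /= ?tSb; ring.
Qed.

Lemma rowop00 a b c k : rowop 0 0 (tdet a b c k) = (c%:Z + k)%:~R * tdet a b c k.
Proof.
rewrite rowE !rowop_z !simp01 /tdet exprzS; move: (N ^ _) => g.
transitivity (c%:R * t a b c * (N * g) + k%:~R * t a b c * g * N); last by ring.
by rewrite t_deriv0 /detz; ring.
Qed.

Lemma rowop01 a b c k :
  rowop 0 1 (tdet a b c k) = c.+1%:Z%:~R * tdet a b c.+1 k.
Proof.
rewrite rowE !rowop_z !simp01 /tdet exprzS; move: (N ^ _) => g.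
transitivity (c.+1%:R * t a b c.+1 * (N * g)); last by ring.
by rewrite t_deriv /detz; ring.
Qed.

Lemma rowop10 a b c k :
  rowop 1 0 (tdet a b c k) = ((a + b).+1%:Z - c%:Z)%:~R * tpdet a b c k.
Proof.
rewrite rowE !rowop_z !simp01 /tdet /tpdet exprzS; move: (N ^ _) => g.
transitivity (((a + b).+1%:R - c%:R) * tp a b c * (N * g)); last by ring.
by rewrite tp_deriv1 /detz; ring.
Qed.

Lemma rowop11 a b c k :
  rowop 1 1 (tdet a b c k) = (a%:Z + b%:Z - c%:Z + k)%:~R * tdet a b c k.
Proof.
rewrite rowE !rowop_z !simp01 /tdet exprzS; move: (N ^ _) => g.
transitivity ((a%:R + b%:R - c%:R) * t a b c * (N * g) + k%:~R * t a b c * g * N);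
  last by ring.
by rewrite t_deriv1 /detz; ring.
Qed.

(** Differentiating t contributes n + 1 to the first coefficient, and the N-term in the expansion of
    z22 t contributes k. The prefactor n + 1 keeps all coefficients integral, here and in the next
    formulas. *)
Lemma D00_tdet a b c k : (a + b).+1%:Z%:~R * D 0 0 (tdet a b c k) =
  (a%:Z * ((a + b).+1%:Z + k))%:~R * tpdet a.-1 b c k
  + (k * ((a + b).+1%:Z - c%:Z))%:~R * tdet a b.+1 c (k - 1).
Proof.
rewrite DE !D_z !simp01 /tdet /tpdet exprzS; move: (N ^ _) => g.
transitivity (a%:R * (a + b).+1%:R * tp a.-1 b c * (N * g)
  + k%:~R * g * ((a + b).+1%:R * (z 1 1 * t a b c))); first by ring.
by rewrite mul_z22; ring.
Qed.

Lemma D01_tdet a b c k : (a + b).+1%:Z%:~R * D 0 1 (tdet a b c k) =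
  (b%:Z * ((a + b).+1%:Z + k))%:~R * tpdet a b.-1 c k
  - (k * ((a + b).+1%:Z - c%:Z))%:~R * tdet a.+1 b c (k - 1).
Proof.
rewrite DE !D_z !simp01 /tdet /tpdet exprzS; move: (N ^ _) => g.
transitivity (b%:R * (a + b).+1%:R * tp a b.-1 c * (N * g)
  - k%:~R * g * ((a + b).+1%:R * (z 1 0 * t a b c))); first by ring.
by rewrite mul_z21; ring.
Qed.

Lemma D10_tdet a b c k : (a + b).+1%:Z%:~R * D 1 0 (tdet a b c k) =
  (a%:Z * ((a + b).+1%:Z + k))%:~R * tdet a.-1 b c k
  - (k * c.+1%:Z)%:~R * tdet a b.+1 c.+1 (k - 1).
Proof.
rewrite DE !D_z !simp01 /tdet exprzS; move: (N ^ _) => g.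
transitivity (a%:R * (a + b).+1%:R * t a.-1 b c * (N * g)
  - k%:~R * g * ((a + b).+1%:R * (z 0 1 * t a b c))); first by ring.
by rewrite mul_z12; ring.
Qed.

Lemma D11_tdet a b c k : (a + b).+1%:Z%:~R * D 1 1 (tdet a b c k) =
  (b%:Z * ((a + b).+1%:Z + k))%:~R * tdet a b.-1 c k
  + (k * c.+1%:Z)%:~R * tdet a.+1 b c.+1 (k - 1).
Proof.
rewrite DE !D_z !simp01 /tdet exprzS; move: (N ^ _) => g.
transitivity (b%:R * (a + b).+1%:R * t a b.-1 c * (N * g)
  + k%:~R * g * ((a + b).+1%:R * (z 0 0 * t a b c))); first by ring.
by rewrite mul_z11; ring.
Qed.

Lemma exprzS1 k : N ^ (k + 1) = N * N ^ k.
Proof. by rewrite exprzS addrK. Qed.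

Definition Cop i j f := z i 0 * colop 0 j f + z i 1 * colop 1 j f + 2%:R * f * z i j.

(** Expanding z11 t(a,b,c) and z12 t(a+1,b-1,c), the leading coefficients add up to (a+k+2) + b, and
    the N-terms to b(a+k+2) - b(a+1) = b(k+1). *)
Lemma Cop00 a b c k : (a + b).+1%:Z%:~R * Cop 0 0 (tdet a b c k) =
  (c.+1%:Z * (a%:Z + b%:Z + k + 2))%:~R * tdet a.+1 b c.+1 k
  + (b%:Z * (k + 1))%:~R * tdet a b.-1 c (k + 1).
Proof.
rewrite /Cop colop00 colop10 /tdet exprzS1; move: (N ^ _) => g.
transitivity ((a%:R + k%:~R + 2%:R) * g * ((a + b).+1%:R * (z 0 0 * t a b c))
   + b%:R * g * ((a + b).+1%:R * (z 0 1 * t a.+1 b.-1 c))); first by ring.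
rewrite mul_z11; case: b => [|b]; first by rewrite addn0; ring.
by rewrite addnS -addSn mul_z12; ring.
Qed.

Lemma Cop01 a b c k : (a + b).+1%:Z%:~R * Cop 0 1 (tdet a b c k) =
  (c.+1%:Z * (a%:Z + b%:Z + k + 2))%:~R * tdet a b.+1 c.+1 k
  - (a%:Z * (k + 1))%:~R * tdet a.-1 b c (k + 1).
Proof.
rewrite /Cop colop01 colop11 /tdet exprzS1; move: (N ^ _) => g.
transitivity ((b%:R + k%:~R + 2%:R) * g * ((a + b).+1%:R * (z 0 1 * t a b c))
   + a%:R * g * ((a + b).+1%:R * (z 0 0 * t a.-1 b.+1 c))); first by ring.
rewrite mul_z12; case: a => [|a]; first by rewrite add0n; ring.
by rewrite addSn -addnS mul_z11; ring.
Qed.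

Lemma Cop10 a b c k : (a + b).+1%:Z%:~R * Cop 1 0 (tdet a b c k) =
  (((a + b).+1%:Z - c%:Z) * (a%:Z + b%:Z + k + 2))%:~R * tdet a.+1 b c k
  - (b%:Z * (k + 1))%:~R * tpdet a b.-1 c (k + 1).
Proof.
rewrite /Cop colop00 colop10 /tdet /tpdet exprzS1; move: (N ^ _) => g.
transitivity ((a%:R + k%:~R + 2%:R) * g * ((a + b).+1%:R * (z 1 0 * t a b c))
   + b%:R * g * ((a + b).+1%:R * (z 1 1 * t a.+1 b.-1 c))); first by ring.
rewrite mul_z21; case: b => [|b]; first by rewrite addn0; ring.
by rewrite addnS -addSn mul_z22; ring.
Qed.

Lemma Cop11 a b c k : (a + b).+1%:Z%:~R * Cop 1 1 (tdet a b c k) =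
  (((a + b).+1%:Z - c%:Z) * (a%:Z + b%:Z + k + 2))%:~R * tdet a b.+1 c k
  + (a%:Z * (k + 1))%:~R * tpdet a.-1 b c (k + 1).
Proof.
rewrite /Cop colop01 colop11 /tdet /tpdet exprzS1; move: (N ^ _) => g.
transitivity ((b%:R + k%:~R + 2%:R) * g * ((a + b).+1%:R * (z 1 1 * t a b c))
   + a%:R * g * ((a + b).+1%:R * (z 1 0 * t a.-1 b.+1 c))); first by ring.
rewrite mul_z22; case: a => [|a]; first by rewrite add0n; ring.
by rewrite addSn -addnS mul_z21; ring.
Qed.

(** * Spans of the t(a,b,c) N^k over a set of K-types, and their stability *)

Definition key : Type := (nat * nat * nat * int)%type.
Definition vec (q : key) : F := tdet q.1.1.1 q.1.1.2 q.1.2 q.2.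

Definition tspan (P : nat -> int -> bool) (x : F) : Prop :=
  exists s : seq (C * key),
    all (fun e => (e.2.1.2 <= e.2.1.1.1 + e.2.1.1.2)%N
                  && P (e.2.1.1.1 + e.2.1.1.2)%N e.2.2) s
    /\ x = \sum_(e <- s) cF e.1 * vec e.2.

Lemma tspan_closed P : closed_sub cF (tspan P).
Proof.
split; last split.
- by exists [::]; rewrite big_nil.
- move=> _ _ [s [Ps ->]] [r [Pr ->]]; exists (s ++ r).
  by rewrite all_cat Ps Pr big_cat.
- move=> c _ [s [Ps ->]]; exists [seq (c * e.1, e.2) | e <- s].
  rewrite all_map; split=> //; rewrite big_map mulr_sumr.
  by apply: eq_bigr => e _; rewrite rmorphM mulrA.
Qed.

(** Beyond c = a + b the generator is zero, so an operator that raises c past the top stays in the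
    span. *)
Lemma tspan_tdet (P : nat -> int -> bool) a b c k :
  P (a + b)%N k -> tspan P (tdet a b c k).
Proof.
move=> Pk; have [cab|abc] := leqP c (a + b).
  exists [:: (1, (a, b, c, k))]; rewrite /= cab Pk.
  by rewrite big_seq1 rmorph1 mul1r.
by rewrite /tdet t_out // mul0r; exact: (tspan_closed P).1.
Qed.

Lemma tspan_tpdet (P : nat -> int -> bool) a b c k :
  P (a + b)%N k -> tspan P (tpdet a b c k).
Proof.
case: c => [|c] Pk; first by rewrite /tpdet tp0 mul0r; exact: (tspan_closed P).1.
by rewrite /tpdet tpS; exact: tspan_tdet.
Qed.

Lemma tspan_ind (P : nat -> int -> bool) (S : F -> Prop) :
  closed_sub cF S ->
  (forall a b c k, (c <= a + b)%N -> P (a + b)%N k -> S (tdet a b c k)) ->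
  forall x, tspan P x -> S x.
Proof.
move=> S_sub Sgen _ [s [/allP Ps ->]]; rewrite big_seq_cond.
apply: (sub_sum S_sub) => e; rewrite andbT => /Ps /andP[ce Pe].
by apply: (subZ S_sub); exact: Sgen.
Qed.

Lemma tspan_mono (P Q : nat -> int -> bool) x :
  (forall n k, P n k -> Q n k) -> tspan P x -> tspan Q x.
Proof.
move=> PQ; apply: tspan_ind => [|a b c k _ Pk]; first exact: tspan_closed.
by apply: tspan_tdet; exact: PQ.
Qed.

(** Lets [tspan_ind] show that a linear operator preserves a span, with the preimage of the span as
    target. *)
Lemma closed_sub_preim (S : F -> Prop) (f : F -> F) :
  {morph f : x y / x + y} -> (forall c x, f (cF c * x) = cF c * f x) ->
  closed_sub cF S -> closed_sub cF (fun x => S (f x)).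
Proof.
move=> fD fZ S_sub; split; last split.
- by rewrite -[0](mul0r 0) -(rmorph0 cF) fZ rmorph0 mul0r; exact: (sub0 S_sub).
- by move=> x y Sx Sy; rewrite fD; exact: (subD S_sub).
- by move=> c x Sx; rewrite fZ; exact: (subZ S_sub).
Qed.

Lemma D_scale i j c x : D i j (cF c * x) = cF c * D i j x.
Proof. by rewrite (derM (D_der i j)) D_cst mul0r add0r. Qed.

Lemma colop_scale i j c x : colop i j (cF c * x) = cF c * colop i j x.
Proof. by rewrite /colop !D_scale; ring. Qed.

Lemma rowop_scale i j c x : rowop i j (cF c * x) = cF c * rowop i j x.
Proof. by rewrite /rowop !D_scale; ring. Qed.

Lemma Cop_scale i j c x : Cop i j (cF c * x) = cF c * Cop i j x.
Proof. by rewrite /Cop !colop_scale; ring. Qed.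

Lemma Cop_add i j : {morph Cop i j : x y / x + y}.
Proof. by move=> x y; rewrite /Cop !(derD (colop_der _ _)); ring. Qed.

(** Entrywise form of invariance; [stable_rho] and [rho_stable] pass between it and the action. *)
Definition stable (S : F -> Prop) : Prop := forall f, S f -> forall i j,
  [/\ S (D i j f), S (rowop i j f), S (colop i j f) & S (Cop i j f)].

Lemma ord2P (i : 'I_2) : i = 0 \/ i = 1.
Proof. by case: i => [[|[]]] //= ?; [left|right]; exact: val_inj. Qed.

(** On a generator each operator gives at most two generators; whenever a coefficient is nonzero,
    [moves] keeps the new K-type in [P]. *)
Lemma tspan_stable (P : nat -> int -> bool) : moves P -> stable (tspan P).
Proof.
move=> [P1 P2 P3 P4] f Pf i j.
have S_sub := tspan_closed P.
have L0 n : n.+1%:Z != 0 by [].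
have Z := subZint S_sub.
split; move: f Pf; apply: tspan_ind.
- by apply: closed_sub_preim => //; [exact: (derD (D_der i j))|exact: D_scale].
- move=> a b c k cab Pk; apply: (subZint_cancel S_sub (L0 (a + b)%N)).
  case: (ord2P i) => ->; case: (ord2P j) => ->.
  + rewrite D00_tdet; apply: (subD S_sub); apply: Z => m0.
      (* A nonzero coefficient excludes a = 0, so the degree really drops by one. *)
      apply: tspan_tpdet; case: a m0 cab Pk => [|a] m0 cab Pk //=.
      by apply: P1 => //; lia.
    apply: tspan_tdet; rewrite addnS; apply: P2 => //; lia.
  + rewrite D01_tdet; apply: (subB S_sub); apply: Z => m0.
      apply: tspan_tpdet; case: b m0 cab Pk => [|b] m0 cab Pk; first by rewrite mul0r in m0.
      rewrite addnS in Pk; apply: P1 => //; lia.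
    apply: tspan_tdet; rewrite addSn; apply: P2 => //; lia.
  + rewrite D10_tdet; apply: (subB S_sub); apply: Z => m0.
      apply: tspan_tdet; case: a m0 cab Pk => [|a] m0 cab Pk //=.
      by apply: P1 => //; lia.
    apply: tspan_tdet; rewrite addnS; apply: P2 => //; lia.
  + rewrite D11_tdet; apply: (subD S_sub); apply: Z => m0.
      apply: tspan_tdet; case: b m0 cab Pk => [|b] m0 cab Pk; first by rewrite mul0r in m0.
      rewrite addnS in Pk; apply: P1 => //; lia.
    apply: tspan_tdet; rewrite addSn; apply: P2 => //; lia.
- by apply: closed_sub_preim => //; [exact: (derD (rowop_der i j))|exact: rowop_scale].
- move=> a b c k cab Pk.
  case: (ord2P i) => ->; case: (ord2P j) => ->.
  + by rewrite rowop00; apply: Z => _; exact: tspan_tdet.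
  + by rewrite rowop01; apply: Z => _; exact: tspan_tdet.
  + by rewrite rowop10; apply: Z => _; exact: tspan_tpdet.
  + by rewrite rowop11; apply: Z => _; exact: tspan_tdet.
- by apply: closed_sub_preim => //; [exact: (derD (colop_der i j))|exact: colop_scale].
- move=> a b c k cab Pk.
  case: (ord2P i) => ->; case: (ord2P j) => ->.
  + by rewrite colop00; apply: Z => _; exact: tspan_tdet.
  + rewrite colop01; apply: Z; case: a Pk {cab} => // a Pk _.
    by apply: tspan_tdet; rewrite addnS -addSn.
  + rewrite colop10; apply: Z; case: b Pk {cab} => // b Pk _.
    by apply: tspan_tdet; rewrite addSn -addnS.
  + by rewrite colop11; apply: Z => _; exact: tspan_tdet.
- by apply: closed_sub_preim => //; [exact: Cop_add|exact: Cop_scale].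
- move=> a b c k cab Pk; apply: (subZint_cancel S_sub (L0 (a + b)%N)).
  case: (ord2P i) => ->; case: (ord2P j) => ->.
  + rewrite Cop00; apply: (subD S_sub); apply: Z => m0.
      by apply: tspan_tdet; rewrite addSn; apply: P3 => //; lia.
    apply: tspan_tdet; case: b m0 cab Pk => [|b] m0 cab Pk; first by rewrite mul0r in m0.
    by rewrite addnS in Pk; apply: P4 => //; lia.
  + rewrite Cop01; apply: (subB S_sub); apply: Z => m0.
      by apply: tspan_tdet; rewrite addnS; apply: P3 => //; lia.
    apply: tspan_tdet; case: a m0 cab Pk => [|a] m0 cab Pk; first by rewrite mul0r in m0.
    by apply: P4 => //; lia.
  + rewrite Cop10; apply: (subB S_sub); apply: Z => m0.
      by apply: tspan_tdet; rewrite addSn; apply: P3 => //; lia.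
    apply: tspan_tpdet; case: b m0 cab Pk => [|b] m0 cab Pk; first by rewrite mul0r in m0.
    by rewrite addnS in Pk; apply: P4 => //; lia.
  + rewrite Cop11; apply: (subD S_sub); apply: Z => m0.
      by apply: tspan_tdet; rewrite addnS; apply: P3 => //; lia.
    apply: tspan_tpdet; case: a m0 cab Pk => [|a] m0 cab Pk; first by rewrite mul0r in m0.
    by apply: P4 => //; lia.
Qed.

(** * The action in the abstract model and its matrix entries *)

Definition dmat (f : F) : 'M[F]_2 := \matrix_(i < 2, j < 2) D j i f.

Definition rho (A B Cm Dm : 'M[C]_2) (f : F) : F :=
  \tr (map_mx cF A *m (- (z *m dmat f) - f%:M))
  + \tr (map_mx cF B *m (- dmat f))
  + \tr (map_mx cF Cm *m (z *m dmat f *m z + (2%:R * f) *: z))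
  + \tr (map_mx cF Dm *m (dmat f *m z + f%:M)).

Lemma z_dmatE f i j : (z *m dmat f) i j = rowop i j f.
Proof. by rewrite mxE sum2 !mxE /rowop; ring. Qed.

Lemma dmat_zE f i j : (dmat f *m z) i j = colop i j f.
Proof. by rewrite mxE sum2 !mxE. Qed.

Lemma CmatE f i j : (z *m dmat f *m z + (2%:R * f) *: z) i j = Cop i j f.
Proof. by rewrite -mulmxA mxE mxE sum2 !dmat_zE mxE /Cop. Qed.

Lemma mxtrace_cmul (A : 'M[C]_2) (M : 'M[F]_2) :
  \tr (map_mx cF A *m M) = \sum_i \sum_j cF (A i j) * M j i.
Proof.
by apply: eq_bigr => i _; rewrite mxE; apply: eq_bigr => j _; rewrite mxE.
Qed.

Lemma stable_rho (S : F -> Prop) : closed_sub cF S -> stable S ->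
  forall A B Cm Dm f, S f -> S (rho A B Cm Dm f).
Proof.
move=> S_sub S_st A B Cm Dm f Sf.
have tr_in X (M : 'M[F]_2) : (forall i j, S (M i j)) -> S (\tr (map_mx cF X *m M)).
  move=> SM; rewrite mxtrace_cmul; apply: (sub_sum S_sub) => i _.
  by apply: (sub_sum S_sub) => j _; exact: (subZ S_sub).
have Sf1 i j : S ((f%:M : 'M[F]_2) i j).
  by rewrite mxE; case: (i == j); rewrite ?mulr1n ?mulr0n //; exact: (sub0 S_sub).
apply: (subD S_sub); first (apply: (subD S_sub); first apply: (subD S_sub)).
all: apply: tr_in => i j; have [SD Sr Sc SC] := S_st f Sf i j.
- rewrite mxE [X in X + _]mxE z_dmatE [X in _ + X]mxE.
  by apply: (subB S_sub) => //; exact: (subN S_sub).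
- by rewrite !mxE; apply: (subN S_sub); have [] := S_st f Sf j i.
- by rewrite CmatE.
- by rewrite mxE dmat_zE; exact: (subD S_sub).
Qed.

Lemma mxtrace_delta (M : 'M[F]_2) i j :
  \tr (map_mx cF (delta_mx j i) *m M) = M i j.
Proof.
rewrite mxtrace_cmul (bigD1 j) //= (bigD1 i) //= !mxE !eqxx rmorph1 mul1r.
rewrite big1 ?addr0 => [|k /negbTE kj]; last by rewrite !mxE kj andbF rmorph0 mul0r.
rewrite big1 ?addr0 // => k /negbTE kj; rewrite big1 // => l _.
by rewrite !mxE kj rmorph0 mul0r.
Qed.

(** Elementary matrices in a single block isolate one entry; the extra multiple of f in the blocks A
    and D already lies in [W]. *)
Lemma rho_stable (W : F -> Prop) : closed_sub cF W ->
  (forall A B Cm Dm f, W f -> W (rho A B Cm Dm f)) -> stable W.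
Proof.
move=> W_sub W_rho f Wf i j.
have tr0 (M : 'M[F]_2) : \tr (map_mx cF 0 *m M) = 0.
  by rewrite map_mx0 mul0mx mxtrace0.
have Wf1 k l : W ((f%:M : 'M[F]_2) k l).
  by rewrite mxE; case: (k == l); rewrite ?mulr1n ?mulr0n //; exact: (sub0 W_sub).
split.
(* The matrix of derivatives is transposed, hence [delta_mx i j] here and [delta_mx j i] in the
   other blocks. *)
- have := W_rho 0 (delta_mx i j) 0 0 f Wf.
  rewrite /rho !tr0 mxtrace_delta add0r !addr0 !mxE => /(subN W_sub).
  by rewrite opprK.
- have := W_rho (delta_mx j i) 0 0 0 f Wf.
  rewrite /rho !tr0 mxtrace_delta !addr0 mxE [X in X + _]mxE [X in _ + X]mxE z_dmatE.
  by move=> /(subD W_sub)/(_ (Wf1 i j))/(subN W_sub); rewrite addrNK opprK.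
- have := W_rho 0 0 0 (delta_mx j i) f Wf.
  rewrite /rho !tr0 mxtrace_delta !add0r mxE dmat_zE.
  by move=> /(subB W_sub)/(_ (Wf1 i j)); rewrite addrK.
- have := W_rho 0 0 (delta_mx j i) 0 f Wf.
  by rewrite /rho !tr0 mxtrace_delta !add0r !addr0 CmatE.
Qed.

(* The last operator plays the role of the Casimir element of sl(2): given
   a - b, the value a(b+1) determines a >= 0. *)
Definition wtop (i : nat) : F -> F :=
  match i with
  | 0%N => colop 0 0
  | 1%N => colop 1 1
  | 2%N => rowop 0 0
  | _ => fun f => colop 1 0 (colop 0 1 f)
  end.

Definition weight (i : nat) (q : key) : int :=
  match i with
  | 0%N => q.1.1.1%:Z + q.2
  | 1%N => q.1.1.2%:Z + q.2
  | 2%N => q.1.2%:Z + q.2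
  | _ => q.1.1.1%:Z * q.1.1.2.+1%:Z
  end.

Lemma wtop_add i : {morph wtop i : x y / x + y}.
Proof.
move: i => [|[|[|i]]] x y /=; rewrite ?(derD (colop_der 0 _)) ?(derD (colop_der 1 _)) //.
exact: (derD (rowop_der 0 0)).
Qed.

Lemma wtop_scale i c x : wtop i (cF c * x) = cF c * wtop i x.
Proof. by move: i => [|[|[|i]]] /=; rewrite ?colop_scale ?rowop_scale. Qed.

Lemma wtop_vec i q : wtop i (vec q) = (weight i q)%:~R * vec q.
Proof.
move: q => [[[a b] c] k]; move: i => [|[|[|i]]] /=; rewrite /vec /=.
- exact: colop00.
- exact: colop11.
- exact: rowop00.
rewrite colop01 -(rmorph_int cF) colop_scale colop10 rmorph_int.
by case: a => [|a] /=; ring.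
Qed.

Lemma weight_sep q q' : q != q' -> exists i, weight i q != weight i q'.
Proof.
move: q q' => [[[a b] c] k] [[[a' b'] c'] k'] qq'.
have [E0|] := eqVneq (weight 0 (a, b, c, k)) (weight 0 (a', b', c', k')); last by exists 0%N.
have [E1|] := eqVneq (weight 1 (a, b, c, k)) (weight 1 (a', b', c', k')); last by exists 1%N.
have [E2|] := eqVneq (weight 2 (a, b, c, k)) (weight 2 (a', b', c', k')); last by exists 2%N.
have [E3|] := eqVneq (weight 3 (a, b, c, k)) (weight 3 (a', b', c', k')); last by exists 3%N.
case/eqP: qq'; rewrite /= in E0 E1 E2 E3.
(* The first two weights give a - b = a' - b', so the difference of the fourth weights factors; the
   second factor is positive. *)
have /eqP : (a%:Z - a'%:Z) * (b'%:Z + a%:Z + 1) = 0 by nia.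
rewrite mulf_eq0 => /orP[] /eqP Ea; last by lia.
by congr (_, _, _, _); lia.
Qed.

Lemma stable_wtop (W : F -> Prop) : stable W ->
  forall i x, W x -> W (wtop i x).
Proof.
move=> W_st [|[|[|i]]] x Wx /=.
- by have [] := W_st x Wx 0 0.
- by have [] := W_st x Wx 1 1.
- by have [] := W_st x Wx 0 0.
have [_ _ Wy _] := W_st x Wx 0 1.
by have [] := W_st _ Wy 1 0.
Qed.

(** The zero subspace is invariant, so separation applies to it: the part of the vanishing sum with
    keys in [P] vanishes, and this part is x. *)
Lemma tspan_direct (P Q : nat -> int -> bool) x y :
  (forall n k, P n k -> ~~ Q n k) -> tspan P x -> tspan Q y -> x + y = 0 ->
  x = 0.
Proof.
move=> PQ [s [/allP Ps ->]] [r [/allP Qr ->]] E.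
pose P' (q : key) := P (q.1.1.1 + q.1.1.2)%N q.2.
have W_sub : closed_sub cF (fun x => x = 0).
  split=> //; split=> [u v -> ->|c u ->]; [exact: addr0|exact: mulr0].
have W_T i u : u = 0 -> wtop i u = 0.
  by move=> ->; have := wtop_scale i 0 0; rewrite rmorph0 !mul0r.
have := @sub_filter _ _ cF _ vec _ _ _ wtop_add wtop_scale wtop_vec weight_sep
  _ W_sub W_T (s ++ r) P'.
rewrite !big_cat /= => /(_ E).
rewrite [X in _ + X]big1_seq ?addr0; last first.
  by move=> e /andP[Pe /Qr /andP[_ Qe]]; case/negP: (PQ _ _ Pe); exact: Qe.
move=> E0; rewrite -[RHS]E0 [LHS]big_seq_cond [RHS]big_seq_cond; apply: eq_bigl => e.
by case es: (e \in s) => //=; rewrite /P'; have /andP[_ ->] := Ps _ es.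
Qed.

(** * Invariant subspaces are unions of whole K-types joined by steps *)

Section Irreducibility.
Variables (W : F -> Prop) (W_sub : closed_sub cF W) (W_st : stable W).

Definition full n k : Prop :=
  forall a b c, (a + b = n)%N -> (c <= n)%N -> W (tdet a b c k).

Let W_cancel (m : int) x : m != 0 -> W (m%:~R * x) -> W x.
Proof. exact: (subZint_cancel W_sub). Qed.

(** Irreducibility of one K-type: c and then a are lowered to 0, then a and c are raised to any
    value, always with nonzero coefficients. *)
Lemma full_tdet a b c k : (c <= a + b)%N -> W (tdet a b c k) -> full (a + b) k.
Proof.
move=> cab Wt.
have down_c b' d : (d <= a + b')%N -> W (tdet a b' d k) -> W (tdet a b' 0 k).
  elim: d => // d IHd dab Wd; apply: IHd; first exact: ltnW.
  have [_ + _ _] := W_st Wd 1 0; rewrite rowop10 /tpdet tpS => /W_cancel; apply.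
  by lia.
have down_a a' b' : W (tdet a' b' 0 k) -> W (tdet 0 (a' + b') 0 k).
  elim: a' b' => // a' IHa b' Wa; rewrite addSnnS; apply: IHa.
  by have [_ _ + _] := W_st Wa 0 1; rewrite colop01 => /W_cancel; apply.
have W0 := down_a _ _ (down_c _ _ cab Wt).
move=> a' b' c' ab' c'ab; have W1 : W (tdet a' b' 0 k).
  elim: a' b' ab' => [|a' IHa] b' ab'; first by rewrite -[b']add0n ab'.
  have [|_ _ + _] := W_st (IHa b'.+1 _) 1 0; first by rewrite -ab' addSnnS.
  by rewrite colop10 => /W_cancel; apply.
elim: c' {c'ab} => // c' IHc.
by have [_ + _ _] := W_st IHc 0 1; rewrite rowop01 => /W_cancel; apply.
Qed.

Lemma full_two p q (m1 m2 : int) : p != q -> m1 != 0 ->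
  W (m1%:~R * vec p + m2%:~R * vec q) -> W (vec p).
Proof.
move=> pq m10; rewrite -!(rmorph_int cF).
move=> /(sub_two wtop_add wtop_scale wtop_vec weight_sep W_sub (stable_wtop W_st) pq).
by rewrite rmorph_int; exact: W_cancel.
Qed.

(** One operator applied to t(0,n,0) N^k gives two generators of distinct weight. Separation
    isolates the wanted one, and [full_tdet] fills its K-type. *)
Lemma full_moves : moves full.
Proof.
have full0 n k : full n k -> W (tdet 0 n 0 k) by move/(_ 0%N n 0%N); exact.
have WL n x : W x -> W (n.+1%:Z%:~R * x) by move=> Wx; apply: (subZint W_sub).
split=> n k nk0 /full0 Wn.
- have [Wd _ _ _] := W_st Wn 1 1; have := WL (0 + n.+1)%N _ Wd.
  rewrite D11_tdet => /(@full_two (0%N, n, 0%N, k) (1%N, n.+1, 1%N, k - 1)) /= H.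
  by apply: (@full_tdet 0 n 0) => //; apply: H; rewrite ?mulf_neq0 //; lia.
- have [Wd _ _ _] := W_st Wn 1 1; have := WL (0 + n)%N _ Wd.
  (* For n = 0 the key with [n.-1] is a dummy of coefficient 0, still distinct from the other
     key. *)
  rewrite D11_tdet addrC => /(@full_two (1%N, n, 1%N, k - 1) (0%N, n.-1, 0%N, k)) /= H.
  by apply: (@full_tdet 1 n 1) => //; apply: H; rewrite ?mulf_neq0 //; lia.
- have [_ _ _ Wd] := W_st Wn 0 0; have := WL (0 + n)%N _ Wd.
  rewrite Cop00 => /(@full_two (1%N, n, 1%N, k) (0%N, n.-1, 0%N, k + 1)) /= H.
  by apply: (@full_tdet 1 n 1) => //; apply: H; rewrite ?mulf_neq0 //; lia.
- have [_ _ _ Wd] := W_st Wn 0 0; have := WL (0 + n.+1)%N _ Wd.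
  rewrite Cop00 addrC => /(@full_two (0%N, n, 0%N, k + 1) (1%N, n.+1, 1%N, k)) /= H.
  by apply: (@full_tdet 0 n 0) => //; apply: H; rewrite ?mulf_neq0 //; lia.
Qed.

End Irreducibility.

(** A nonzero element puts one generator in [W], hence its K-type, hence by connectedness every
    K-type of the region. *)
Lemma tspan_irreducible (P : nat -> int -> bool) (W : F -> Prop) :
  (forall Q, moves Q -> forall n k n' k', P n k -> P n' k' -> Q n k -> Q n' k') ->
  closed_sub cF W -> stable W -> (forall x, W x -> tspan P x) ->
  (forall x, W x -> x = 0) \/ (forall x, tspan P x -> W x).
Proof.
move=> connected W_sub W_st WP.
(* Whether an arbitrary [W] has a nonzero element is decided by excluded middle. *)
have [[x [Wx x0]]|no_x] := classic (exists x, W x /\ x <> 0); last first.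
  left=> x Wx; apply/eqP; apply: contra_notT no_x => /eqP x0.
  by exists x.
right; have [s [/allP Ps Ex]] := WP x Wx.
have x0' : \sum_(e <- s) cF e.1 * vec e.2 != 0 by rewrite -Ex; apply/eqP.
rewrite Ex in Wx.
have [q /mapP[e es ->] Wq] := sub_exists wtop_add wtop_scale wtop_vec weight_sep
  W_sub (stable_wtop W_st) Wx x0'.
have /andP[ce Pe] := Ps e es.
have Wfull := full_tdet W_sub W_st ce Wq.
apply: tspan_ind => // a b c k cab Pk.
have := connected _ (full_moves W_sub W_st) _ _ _ _ Pe Pk Wfull.
exact.
Qed.

(** * The span of all generators: products and splitting into three parts *)

Definition any_type (n : nat) (k : int) : bool := true.

(** The expansions of z_ij t(a,b,c) write each product, times n + 1, as a combination of
    generators. *)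
Lemma tspan_any_z i j x : tspan any_type x -> tspan any_type (z i j * x).
Proof.
move: x; have S_sub := tspan_closed any_type.
have L0 n : n.+1%:Z != 0 by [].
have Z := subZint S_sub.
have T a b c k : tspan any_type (tdet a b c k) by exact: tspan_tdet.
have Tp a b c k : tspan any_type (tpdet a b c k) by exact: tspan_tpdet.
apply: tspan_ind => [|a b c k _ _].
  by apply: closed_sub_preim => // [x y|c x]; ring.
apply: (subZint_cancel S_sub (L0 (a + b)%N)); rewrite /tdet.
case: (ord2P i) => ->; case: (ord2P j) => ->.
- suff -> : (a + b).+1%:Z%:~R * (z 0 0 * (t a b c * N ^ k)) =
      c.+1%:Z%:~R * tdet a.+1 b c.+1 k + b%:Z%:~R * tdet a b.-1 c (k + 1).
    by apply: (subD S_sub); apply: Z.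
  transitivity ((a + b).+1%:R * (z 0 0 * t a b c) * N ^ k); first by ring.
  by rewrite mul_z11 /tdet exprzS1; ring.
- suff -> : (a + b).+1%:Z%:~R * (z 0 1 * (t a b c * N ^ k)) =
      c.+1%:Z%:~R * tdet a b.+1 c.+1 k - a%:Z%:~R * tdet a.-1 b c (k + 1).
    by apply: (subB S_sub); apply: Z.
  transitivity ((a + b).+1%:R * (z 0 1 * t a b c) * N ^ k); first by ring.
  by rewrite mul_z12 /tdet exprzS1; ring.
- suff -> : (a + b).+1%:Z%:~R * (z 1 0 * (t a b c * N ^ k)) =
      ((a + b).+1%:Z - c%:Z)%:~R * tdet a.+1 b c k
      - b%:Z%:~R * tpdet a b.-1 c (k + 1).
    by apply: (subB S_sub); apply: Z.
  transitivity ((a + b).+1%:R * (z 1 0 * t a b c) * N ^ k); first by ring.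
  by rewrite mul_z21 /tdet /tpdet exprzS1; ring.
- suff -> : (a + b).+1%:Z%:~R * (z 1 1 * (t a b c * N ^ k)) =
      ((a + b).+1%:Z - c%:Z)%:~R * tdet a b.+1 c k
      + a%:Z%:~R * tpdet a.-1 b c (k + 1).
    by apply: (subD S_sub); apply: Z.
  transitivity ((a + b).+1%:R * (z 1 1 * t a b c) * N ^ k); first by ring.
  by rewrite mul_z22 /tdet /tpdet exprzS1; ring.
Qed.

Lemma tspan_any_exprz m x : tspan any_type x -> tspan any_type (x * N ^ m).
Proof.
move: x; apply: tspan_ind => [|a b c k _ _].
  apply: closed_sub_preim; last exact: tspan_closed.
    by move=> x y; rewrite mulrDl.
  by move=> c x; rewrite mulrA.
by rewrite /tdet -mulrA -expfzDr //; exact: tspan_tdet.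
Qed.

Lemma tspan_any1 : tspan any_type 1.
Proof.
have -> : 1 = tdet 0 0 0 0 by rewrite /tdet t000 expr0z mulr1.
exact: tspan_tdet.
Qed.

Lemma tspan_any_split x : tspan any_type x ->
  exists xm x0 xp, [/\ tspan minus_type xm, tspan zero_type x0, tspan plus_type xp
                     & x = xm + x0 + xp].
Proof.
have M := tspan_closed minus_type; have Z := tspan_closed zero_type.
have P := tspan_closed plus_type.
move: x; apply: tspan_ind => [|a b c k cab _].
  split; last split.
  - exists 0, 0, 0; split; rewrite ?addr0 //.
    + exact: (sub0 M).
    + exact: (sub0 Z).
    + exact: (sub0 P).
  - move=> _ _ [xm [x0 [xp [Mx Zx Px ->]]]] [ym [y0 [yp [My Zy Py ->]]]].
    exists (xm + ym), (x0 + y0), (xp + yp); split.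
    + exact: (subD M).
    + exact: (subD Z).
    + exact: (subD P).
    + ring.
  - move=> d _ [xm [x0 [xp [Mx Zx Px ->]]]].
    exists (cF d * xm), (cF d * x0), (cF d * xp); split.
    + exact: (subZ M).
    + exact: (subZ Z).
    + exact: (subZ P).
    + ring.
have [k0|k0] := boolP (plus_type (a + b) k).
  exists 0, 0, (tdet a b c k); split; rewrite ?add0r //.
  - exact: (sub0 M).
  - exact: (sub0 Z).
  - exact: tspan_tdet.
have [km|km] := boolP (minus_type (a + b) k).
  exists (tdet a b c k), 0, 0; split; rewrite ?addr0 //.
  - exact: tspan_tdet.
  - exact: (sub0 Z).
  - exact: (sub0 P).
exists 0, (tdet a b c k), 0; split; rewrite ?add0r ?addr0 //.
- exact: (sub0 M).
- by apply: tspan_tdet; move: k0 km; rewrite /plus_type /minus_type /zero_type; lia.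
- exact: (sub0 P).
Qed.

Lemma tspan_split_unique xm x0 xp :
  tspan minus_type xm -> tspan zero_type x0 -> tspan plus_type xp ->
  xm + x0 + xp = 0 -> [/\ xm = 0, x0 = 0 & xp = 0].
Proof.
move=> Mx Zx Px E.
(* The zero and plus parts are first grouped, so that the two-term statement [tspan_direct] can be
   used twice. *)
have nonneg_sum : tspan (fun n k => zero_type n k || plus_type n k) (x0 + xp).
  apply: (subD (tspan_closed _)).
    by apply: tspan_mono Zx => n k ->.
  by apply: tspan_mono Px => n k ->; rewrite orbT.
have xm0 : xm = 0.
  apply: (tspan_direct _ Mx nonneg_sum); last by rewrite addrA.
  by move=> n k; rewrite /minus_type /zero_type /plus_type; lia.
have E' : x0 + xp = 0 by rewrite xm0 add0r in E.
have x00 : x0 = 0.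
  apply: (tspan_direct _ Zx Px E') => n k.
  by rewrite /zero_type /plus_type; lia.
by split=> //; rewrite x00 add0r in E'.
Qed.

End Model.

(** * The concrete field of fractions as an instance of the model *)

Lemma map_polyX_der (R : comNzRingType) (d : R -> R) : derivation d ->
  map_poly d 'X = 0.
Proof.
move=> d_der; apply/polyP=> i.
rewrite coef_map_id0 ?(der0 d_der) // coefX coef0.
by case: (i == 1)%N; rewrite ?(der1 d_der) ?(der0 d_der).
Qed.

Lemma map_polyC_der (R : comNzRingType) (d : R -> R) c : derivation d ->
  map_poly d c%:P = (d c)%:P.
Proof.
move=> d_der; apply/polyP=> i.
rewrite coef_map_id0 ?(der0 d_der) // !coefC.
by case: (i == 0)%N; rewrite ?(der0 d_der).
Qed.

Lemma deriv_der (R : comNzRingType) : derivation (@deriv R).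
Proof. by split=> p q; rewrite ?derivD ?derivM. Qed.

Lemma der_div_exp (K : fieldType) (d : K -> K) (x y : K) k : derivation d -> y != 0 ->
  d (x / y ^+ k) = d x / y ^+ k - (k%:R * x * d y) / y ^+ k.+1.
Proof.
move=> d_der y0; have yk0 : y ^+ k != 0 by rewrite expf_neq0.
rewrite (derM d_der) (derV d_der) // (derX d_der) exprS.
case: k yk0 => [|k] yk0 /=; first by field; rewrite ?y0 ?oner_neq0.
by rewrite !exprS; field; rewrite y0 expf_neq0.
Qed.

Section Instance.
Variable C : numClosedFieldType.
Local Notation F := (F C).
Local Notation P4 := (P4 C).
Local Notation embF := (@embF C).

(** Convertible to [cF], but packaged as a ring morphism. *)
Definition embC : {rmorphism C -> F} :=
  @FracField.tofrac P4 \o polyC \o polyC \o polyC \o polyC.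

Definition dpoly (i j : 'I_2) : P4 -> P4 :=
  if i == 0 then (if j == 0 then @d11 C else @d12 C)
  else (if j == 0 then @d21 C else @d22 C).

Lemma dpoly_der i j : derivation (dpoly i j).
Proof.
rewrite /dpoly /d11 /d12 /d21 /d22.
by case: (i == 0); case: (j == 0); repeat apply: der_map_poly; exact: deriv_der.
Qed.

Definition partial (i j : 'I_2) : F -> F :=
  der_frac (@FracField.tofrac P4) (fun x : F => \n_(repr x)) (fun x : F => \d_(repr x))
    (dpoly i j).

Lemma tofrac_inj : injective (@FracField.tofrac P4).
Proof. by move=> x y /eqP; rewrite tofrac_eq => /eqP. Qed.

Lemma partial_der i j : derivation (partial i j).
Proof.
apply: der_frac_der; [exact: tofrac_inj| | |exact: dpoly_der] => x.
  exact: denom_ratioP.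
exact: fraction_numden.
Qed.

Lemma partial_embF i j p : partial i j (embF p) = embF (dpoly i j p).
Proof.
apply: der_frac_phi; [exact: tofrac_inj| | |exact: dpoly_der] => x.
  exact: denom_ratioP.
exact: fraction_numden.
Qed.

Lemma map_polyC_der0 (R : comNzRingType) (d : R -> R) c :
  derivation d -> d c = 0 -> map_poly d c%:P = 0.
Proof. by move=> d_der dc; rewrite map_polyC_der // dc polyC0. Qed.

Lemma map_polyC_der1 (R : comNzRingType) (d : R -> R) c :
  derivation d -> d c = 1 -> map_poly d c%:P = 1.
Proof. by move=> d_der dc; rewrite map_polyC_der // dc polyC1. Qed.

(** [e0], [e1] and [e2] concern differentiation in a variable lying under zero, one or two further
    polynomial layers. *)
Let e0 (R : comNzRingType) : derivation (@deriv R) := deriv_der R.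
Let e1 (R : comNzRingType) := der_map_poly (e0 R).
Let e2 (R : comNzRingType) := der_map_poly (e1 R).

Let c1 (R : comNzRingType) (c : {poly R}) (h : deriv c = 0) :=
  map_polyC_der0 (e1 R) (map_polyC_der0 (e0 R) h).
Let c2 (R : comNzRingType) (c : {poly R}) (h : deriv c = 0) :=
  map_polyC_der0 (e2 R) (c1 h).

Lemma d11_cst (c : C) : d11 (cst c) = 0.
Proof. exact: derivC. Qed.
Lemma d12_cst (c : C) : d12 (cst c) = 0.
Proof. exact: (map_polyC_der0 (e0 (P2 C)) (derivC _)). Qed.
Lemma d21_cst (c : C) : d21 (cst c) = 0.
Proof. exact: (@c1 (P1 C) _ (derivC _)). Qed.
Lemma d22_cst (c : C) : d22 (cst c) = 0.
Proof. exact: (@c2 C _ (derivC _)). Qed.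

Lemma d11_z11 : d11 (z11 C) = 1. Proof. exact: derivX. Qed.
Lemma d11_z12 : d11 (z12 C) = 0. Proof. exact: derivC. Qed.
Lemma d11_z21 : d11 (z21 C) = 0. Proof. exact: derivC. Qed.
Lemma d11_z22 : d11 (z22 C) = 0. Proof. exact: derivC. Qed.
Lemma d12_z11 : d12 (z11 C) = 0.
Proof. exact: (map_polyX_der (e0 (P2 C))). Qed.
Lemma d12_z12 : d12 (z12 C) = 1.
Proof. exact: (map_polyC_der1 (e0 (P2 C)) (derivX _)). Qed.
Lemma d12_z21 : d12 (z21 C) = 0.
Proof. exact: (map_polyC_der0 (e0 (P2 C)) (derivC _)). Qed.
Lemma d12_z22 : d12 (z22 C) = 0.
Proof. exact: (map_polyC_der0 (e0 (P2 C)) (derivC _)). Qed.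
Lemma d21_z11 : d21 (z11 C) = 0.
Proof. exact: (map_polyX_der (e1 (P1 C))). Qed.
Lemma d21_z12 : d21 (z12 C) = 0.
Proof. exact: (map_polyC_der0 (e1 (P1 C)) (map_polyX_der (e0 (P1 C)))). Qed.
Lemma d21_z21 : d21 (z21 C) = 1.
Proof.
exact: (map_polyC_der1 (e1 (P1 C)) (map_polyC_der1 (e0 (P1 C)) (derivX _))).
Qed.
Lemma d21_z22 : d21 (z22 C) = 0.
Proof. exact: (@c1 (P1 C) _ (derivC _)). Qed.
Lemma d22_z11 : d22 (z11 C) = 0.
Proof. exact: (map_polyX_der (e2 C)). Qed.
Lemma d22_z12 : d22 (z12 C) = 0.
Proof. exact: (map_polyC_der0 (e2 C) (map_polyX_der (e1 C))). Qed.
Lemma d22_z21 : d22 (z21 C) = 0.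
Proof.
exact: (map_polyC_der0 (e2 C) (map_polyC_der0 (e1 C) (map_polyX_der (e0 C)))).
Qed.
Lemma d22_z22 : d22 (z22 C) = 1.
Proof.
exact: (map_polyC_der1 (e2 C)
         (map_polyC_der1 (e1 C) (map_polyC_der1 (e0 C) (derivX _)))).
Qed.

Lemma partial_cst i j c : partial i j (embC c) = 0.
Proof.
rewrite partial_embF; suff -> : dpoly i j (cst c) = 0 by exact: rmorph0.
rewrite /dpoly; case: (i == 0); case: (j == 0).
- exact: d11_cst.
- exact: d12_cst.
- exact: d21_cst.
- exact: d22_cst.
Qed.

Definition zpoly (k l : 'I_2) : P4 :=
  if k == 0 then (if l == 0 then @z11 C else @z12 C)
  else (if l == 0 then @z21 C else @z22 C).

Lemma dpoly_z i j k l : dpoly i j (zpoly k l) = ((i == k) && (j == l))%:R.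
Proof.
case: (ord2P i) => ->; case: (ord2P j) => ->; case: (ord2P k) => ->;
  case: (ord2P l) => ->; rewrite /dpoly /zpoly /=.
- exact: d11_z11.
- exact: d11_z12.
- exact: d11_z21.
- exact: d11_z22.
- exact: d12_z11.
- exact: d12_z12.
- exact: d12_z21.
- exact: d12_z22.
- exact: d21_z11.
- exact: d21_z12.
- exact: d21_z21.
- exact: d21_z22.
- exact: d22_z11.
- exact: d22_z12.
- exact: d22_z21.
- exact: d22_z22.
Qed.

Lemma ZmxE k l : Zmx C k l = embF (zpoly k l).
Proof. by rewrite mxE. Qed.

Lemma partial_Zmx i j k l :
  partial i j (Zmx C k l) = ((i == k) && (j == l))%:R.
Proof. by rewrite ZmxE partial_embF dpoly_z; exact: rmorph_nat. Qed.

Lemma detz_Zmx : detz (Zmx C) = NF C.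
Proof.
rewrite /detz !ZmxE /zpoly /=.
transitivity (@FracField.tofrac P4 (z11 C * z22 C - z12 C * z21 C)); last by [].
by rewrite rmorphB !rmorphM.
Qed.

Lemma coef_gen_morph (R S : comNzRingType) (phi : {rmorphism R -> S}) x y x' y'
    a b c :
  phi (('X * x%:P + y%:P) ^+ a * ('X * x'%:P + y'%:P) ^+ b)`_c =
  (('X * (phi x)%:P + (phi y)%:P) ^+ a * ('X * (phi x')%:P + (phi y')%:P) ^+ b)`_c.
Proof.
by rewrite -coef_map rmorphM !rmorphXn !rmorphD !rmorphM /= !map_polyX !map_polyC.
Qed.

Lemma tE a b c : embF (tlnm C a b c) = t (Zmx C) a b c.
Proof.
rewrite /t /gen /gen_u /gen_v !ZmxE /zpoly /=.
exact: (coef_gen_morph (@FracField.tofrac P4)).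
Qed.

Lemma tNE a b c k : tN C a b c k = tdet (Zmx C) a b c k.
Proof. by rewrite /tN /tdet tE detz_Zmx. Qed.


Lemma NF_neq0 : NF C != 0.
Proof. by rewrite -detz_Zmx; apply: (detz_neq0 partial_der partial_Zmx). Qed.

Lemma dzhE i j p k : dzh (dpoly i j) p k = partial i j (zh p k).
Proof.
rewrite /zh (der_div_exp _ _ (partial_der i j) NF_neq0) /dzh.
by rewrite /NF !partial_embF.
Qed.

Lemma dmxE p k : dmx p k = dmat partial (zh p k).
Proof.
apply/matrixP => i j; rewrite !mxE -dzhE.
by case: (ord2P i) => ->; case: (ord2P j) => ->.
Qed.

(** In particular [rho1] depends only on the element p / N^k and not on the pair (p, k). *)
Lemma rho1E A B Cm Dm p k :
  rho1 A B Cm Dm p k = rho embC (Zmx C) partial A B Cm Dm (zh p k).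
Proof. by rewrite /rho1 dmxE. Qed.

Lemma tN_vec (e : C * key) :
  cF e.1 * tN C e.2.1.1.1 e.2.1.1.2 e.2.1.2 e.2.2 = embC e.1 * vec (Zmx C) e.2.
Proof. by rewrite tNE. Qed.

Lemma ZhSpanE P x : ZhSpan P x <-> tspan embC (Zmx C) P x.
Proof.
have E s := eq_bigr (op := +%R) (idx := 0) (r := s) (P := predT) _ (fun e _ => tN_vec e).
split=> -[s [Ps xs]]; exists s; split; first exact: Ps.
- exact: (etrans xs (E s)).
- exact: Ps.
- exact: (etrans xs (esym (E s))).
Qed.

Lemma poly_morph_ind (R : comNzRingType) (K : comNzRingType) (S : K -> Prop)
    (phi : {rmorphism {poly R} -> K}) :
  (forall x y, S x -> S y -> S (x + y)) ->
  (forall x, S x -> S (phi 'X * x)) -> (forall c, S (phi c%:P)) ->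
  forall p, S (phi p).
Proof.
move=> SD SX SC; apply: poly_ind => [|p c Sp].
  by rewrite -polyC0; exact: SC.
by rewrite rmorphD rmorphM mulrC; apply: SD; [exact: SX|exact: SC].
Qed.

(** Induction through the four polynomial layers: constants are multiples of 1, and each layer adds
    products with one z_ij. *)
Lemma tspan_embF p : tspan embC (Zmx C) any_type (embF p).
Proof.
set S := tspan _ _ _.
have S_sub : closed_sub embC S by exact: tspan_closed.
have SD := subD S_sub.
have Sz i j x : S x -> S (Zmx C i j * x) by exact: (tspan_any_z partial_der partial_Zmx).
pose phi1 : {rmorphism P1 C -> F} :=
  @FracField.tofrac P4 \o polyC \o polyC \o polyC.
pose phi2 : {rmorphism P2 C -> F} := @FracField.tofrac P4 \o polyC \o polyC.
pose phi3 : {rmorphism P3 C -> F} := @FracField.tofrac P4 \o polyC.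
have S1 (q : P1 C) : S (phi1 q).
  apply: (poly_morph_ind (phi := phi1)) => [//|x Sx|c].
    by have := Sz 1 1 x Sx; rewrite ZmxE.
  have -> : phi1 c%:P = embC c * 1 by rewrite mulr1.
  apply: (subZ S_sub).
  exact: (tspan_any1 embC).
have S2 (q : P2 C) : S (phi2 q).
  apply: (poly_morph_ind (phi := phi2)) => [//|x Sx|c]; last exact: S1.
  by have := Sz 1 0 x Sx; rewrite ZmxE.
have S3 (q : P3 C) : S (phi3 q).
  apply: (poly_morph_ind (phi := phi3)) => [//|x Sx|c]; last exact: S2.
  by have := Sz 0 1 x Sx; rewrite ZmxE.
apply: (poly_morph_ind (phi := @FracField.tofrac P4)) => [//|x Sx|c].
  by have := Sz 0 0 x Sx; rewrite ZmxE.
exact: S3.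
Qed.

Lemma isZh_tspan x : isZh x -> tspan embC (Zmx C) any_type x.
Proof.
move=> [p [k ->]]; rewrite /zh -detz_Zmx.
have -> : embF p / detz (Zmx C) ^+ k = embF p * detz (Zmx C) ^ (- k%:Z).
  by rewrite -invr_expz.
exact: (tspan_any_exprz partial_der partial_Zmx _ (tspan_embF p)).
Qed.

Lemma localization_closed (R : comNzRingType) (K : fieldType)
    (phi : {rmorphism R -> K}) (n : R) (cst : C -> R) (cK : {rmorphism C -> K}) :
  (forall c, cK c = phi (cst c)) -> phi n != 0 ->
  closed_sub cK (fun x => exists p k, x = phi p / phi n ^+ k).
Proof.
move=> cKE n0; split; last split.
- by exists 0, 0%N; rewrite rmorph0 mul0r.
- move=> _ _ [p [k ->]] [q [m ->]].
  exists (p * n ^+ m + q * n ^+ k), (k + m)%N.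
  by rewrite addf_div ?expf_neq0 // exprD rmorphD !rmorphM !rmorphXn.
- move=> c _ [p [k ->]]; exists (cst c * p), k.
  by rewrite rmorphM cKE mulrA.
Qed.

Lemma isZh_closed : closed_sub embC (@isZh C).
Proof.
exact: (@localization_closed P4 F (@FracField.tofrac P4) (NZ C) (@cst C) embC
  (fun c => erefl) NF_neq0).
Qed.

(** N^k goes into the numerator or the denominator according to the sign of k. *)
Lemma tspan_isZh P x : tspan embC (Zmx C) P x -> isZh x.
Proof.
apply: tspan_ind => [|a b c k _ _]; first exact: isZh_closed.
rewrite -tNE /tN; case: k => k.
  exists (tlnm C a b c * NZ C ^+ k), 0%N.
  by rewrite /zh expr0 divr1 /Defs.embF rmorphM rmorphXn.
by exists (tlnm C a b c), k.+1; rewrite /zh NegzE -invr_expz.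
Qed.

Lemma ZhSpan_invariant (P : nat -> int -> bool) :
  moves P -> rho1_invariant (@ZhSpan C P).
Proof.
move=> P_moves A B Cm Dm p k /ZhSpanE Sp; apply/ZhSpanE; rewrite rho1E.
apply: stable_rho Sp; first exact: tspan_closed.
exact: (tspan_stable partial_der partial_cst partial_Zmx).
Qed.

Lemma ZhSpan_irreducible (P : nat -> int -> bool) k :
  connected P -> P 0%N k -> rho1_irreducible (@ZhSpan C P).
Proof.
move=> P_conn Pk; split.
  exists (tdet (Zmx C) 0 0 0 k); split.
    by apply/ZhSpanE; exact: tspan_tdet.
  apply/eqP; rewrite /tdet t000 mul1r expfz_neq0 //.
  exact: (detz_neq0 partial_der partial_Zmx).
move=> W W_sub WV W_inv.
have WP x : W x -> tspan embC (Zmx C) P x by move/WV/ZhSpanE.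
have W_rho A B Cm Dm f : W f -> W (rho embC (Zmx C) partial A B Cm Dm f).
  (* [rho1_invariant] speaks only of fractions p / N^m, so the element is first written in this
     form. *)
  move=> Wf; have [p [m Ef]] := tspan_isZh (WP f Wf).
  by rewrite Ef -rho1E; apply: W_inv; rewrite -Ef.
have W_st := rho_stable (W_sub : closed_sub embC W) W_rho.
case: (tspan_irreducible partial_der partial_cst partial_Zmx P_conn
         (W_sub : closed_sub embC W) W_st WP) => H; [by left|right=> x].
by move/ZhSpanE; exact: H.
Qed.

End Instance.

Unset Implicit Arguments.

Theorem mainTheorem2 (C : numClosedFieldType) :
  (* Zh = Zh^- ⊕ Zh^0 ⊕ Zh^+ *)
  ((forall x : F C, isZh x ->
      exists xm x0 xp, Zh_minus xm /\ Zh_zero x0 /\ Zh_plus xp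
                       /\ x = xm + x0 + xp)
   /\ (forall xm x0 xp : F C, Zh_minus xm -> Zh_zero x0 -> Zh_plus xp ->
         xm + x0 + xp = 0 -> xm = 0 /\ x0 = 0 /\ xp = 0))
  (* invariance *)
  /\ rho1_invariant (@Zh_minus C) /\ rho1_invariant (@Zh_zero C)
  /\ rho1_invariant (@Zh_plus C)
  (* irreducibility *)
  /\ rho1_irreducible (@Zh_minus C) /\ rho1_irreducible (@Zh_zero C)
  /\ rho1_irreducible (@Zh_plus C).
Proof.
split.
  split=> [x /isZh_tspan /tspan_any_split [xm [x0 [xp [Mx Zx Px E]]]]|].
    exists xm, x0, xp; split; first exact/(ZhSpanE minus_type).
    split; first exact/(ZhSpanE zero_type).
    by split; first exact/(ZhSpanE plus_type).
  move=> xm x0 xp /(ZhSpanE minus_type) Mx /(ZhSpanE zero_type) Zx.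
  move=> /(ZhSpanE plus_type) Px E.
  by have [-> -> ->] := tspan_split_unique (@partial_der C) (@partial_cst C)
    (@partial_Zmx C) Mx Zx Px E.
split; first exact: (ZhSpan_invariant minus_moves).
split; first exact: (ZhSpan_invariant zero_moves).
split; first exact: (ZhSpan_invariant plus_moves).
(* The exponents -2, -1 and 0 belong to l = 0: N^-2, N^-1 and 1 show that the three summands are
   nonzero. *)
split; first exact: (@ZhSpan_irreducible C minus_type (- 2) minus_connected).
split; first exact: (@ZhSpan_irreducible C zero_type (- 1) zero_connected).
exact: (@ZhSpan_irreducible C plus_type 0 plus_connected).
Qed.
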